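(* For each prime $p$ with $p\ne 2,5,7,23$, there exist integers $a,b,c,d$ satisfying $a\equiv d\pmod 3$, $b\equiv c\pmod 3$, and \[ p=\frac{1}{3}\left(a^2+23b^2+c^2+23d^2\right). \] *)

(* Defs.v *)
From Stdlib Require Export ZArith Znumtheory.

(* Main.v *)
(* With f(x, y) = 3x^2 + 2xy + 8y^2, a = 3x + y, d = y, c = 3z + t and b = t, the claim becomes p = f(x, y) + f(z, t).

   The definite quaternion algebra of discriminant 23 has three types of maximal orders A, B, C, with 4, 2 and 6 units, and an odd p is a sum of two values of f as soon as it is a norm from the lattice Hom(A, C).

   Choose a small odd s such that n = 4p - s^2 is a nonzero square modulo 23.  The order of discriminant -n then embeds into A, B or C, so p is the norm of an element beta of trace s in one of them.  Equivalently, some binary form of discriminant -n extends to a positive ternary form of half-discriminant 23, and these ternary forms fall into three classes.  The binary form comes from an integer a such that -n is a square modulo 4a and -23/a is a square modulo n; such an a is found without Dirichlet's theorem, by averaging sum_(e | a) (e/n) over a with the weight a^(-1/2).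

   Finally, if gamma1 and gamma2 are isogenies of degree 2^j from the order of beta to A and to C, the quaternion conj(gamma1) beta gamma2 / 2^j has norm p and lies in Hom(A, C) under a condition on beta modulo 2^j.  Unless s^2 is 2-adically close to p or p / 7, some pair with j <= 6 works. *)

(* The three orders are locally isomorphic, so congruences on p and s do not single out the one that
   contains beta; hence a transport table for each of them. The trace s is a free parameter and
   serves twice. As -1 is not a square modulo 23, a nonzero square n makes 23 inert in Q(sqrt(-n)),
   the local condition for an embedding into an algebra ramified at 23; and varying s avoids the
   2-adic classes where the transport fails. A bounded list of traces achieves both, which leaves
   finitely many small p.

   A prime a in a progression would be more than the extension problem asks for. A positive divisor
   sum suffices: it stays positive when square factors are divided out, and then forces (r/n) = 1 at
   every prime r dividing a. The weight a^(-1/2) is balanced: at a = k^2 it gives 1/k while the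
   divisor sum is at least 1, so the main term diverges; over the region ef <= N^2 the parts beyond
   N cost about N^(1/2) N^(-1/2), which stays bounded. *)
Require Import Defs.
From Stdlib Require Import ZArith Znumtheory List Bool Lia.
Import ListNotations.
Open Scope Z_scope.

(** * Positive ternary forms of half-discriminant 23 *)

(* (a, b, c, u, v, w) encodes a x^2 + b y^2 + c z^2 + u yz + v xz + w xy. *)
Definition form : Type := Z * Z * Z * Z * Z * Z.

Definition eval (F : form) (x y z : Z) : Z :=
  let '(a, b, c, u, v, w) := F in
  a * x * x + b * y * y + c * z * z + u * y * z + v * x * z + w * x * y.

(* Its values at primitive vectors are the negated discriminants of the restrictions of F to planes. *)
Definition adjoint (F : form) : form :=
  let '(a, b, c, u, v, w) := F in
  (4 * b * c - u * u, 4 * a * c - v * v, 4 * a * b - w * w,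
   2 * (v * w - 2 * a * u), 2 * (u * w - 2 * b * v), 2 * (u * v - 2 * c * w)).

(** Half the determinant of the Hessian matrix of F. *)
Definition halfdisc (F : form) : Z :=
  let '(a, b, c, u, v, w) := F in
  4 * a * b * c + u * v * w - a * u * u - b * v * v - c * w * w.

Definition represents (F : form) (n : Z) : Prop := exists x y z, eval F x y z = n.

Definition positive23 (F : form) : Prop :=
  let '(a, b, c, u, v, w) := F in
  0 < a /\ 0 < 4 * a * b - w * w /\ halfdisc F = 23.

Definition formA : form := (1, 1, 6, 1, 0, 0).
Definition formB : form := (1, 2, 3, 1, 0, 0).
Definition formC : form := (1, 1, 8, 0, 1, 1).

Lemma positive23_minors (a b c u v w : Z) :
  positive23 (a, b, c, u, v, w) ->
  0 < b /\ 0 < c /\ 0 < 4 * b * c - u * u /\ 0 < 4 * a * c - v * v.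
Proof.
  intros (a0 & C0 & D); unfold halfdisc in D.
  assert (b0 : 0 < b) by nia.
  (* Jacobi's identity: a 2 x 2 minor of the adjoint matrix is the determinant times an entry of the
     original one. It carries positivity from one minor to the other two. *)
  assert (EA : (4 * b * c - u * u) * (4 * a * b - w * w)
               = (u * w - 2 * b * v) * (u * w - 2 * b * v) + 4 * b * 23)
    by (rewrite <- D; ring).
  assert (EB : (4 * a * c - v * v) * (4 * a * b - w * w)
               = (v * w - 2 * a * u) * (v * w - 2 * a * u) + 4 * a * 23)
    by (rewrite <- D; ring).
  assert (A0 : 0 < 4 * b * c - u * u).
  { pose proof (Z.square_nonneg (u * w - 2 * b * v)).
    apply (Z.mul_pos_cancel_r _ _ C0); lia. }
  assert (B0 : 0 < 4 * a * c - v * v).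
  { pose proof (Z.square_nonneg (v * w - 2 * a * u)).
    apply (Z.mul_pos_cancel_r _ _ C0); lia. }
  repeat split; trivial; nia.
Qed.

Definition sub_equiv (F G : form) : Prop :=
  positive23 F -> positive23 G /\ forall n, represents (adjoint F) n -> represents (adjoint G) n.

Lemma swap12 (a b c u v w : Z) : sub_equiv (a, b, c, u, v, w) (b, a, c, v, u, w).
Proof.
  intros P; pose proof (positive23_minors _ _ _ _ _ _ P) as (b0 & c0 & A0 & B0).
  destruct P as (a0 & C0 & D); unfold halfdisc in D.
  split; [unfold positive23, halfdisc; lia|].
  intros n (x & y & z & <-); exists y, x, z; unfold eval, adjoint; ring.
Qed.

Lemma swap23 (a b c u v w : Z) : sub_equiv (a, b, c, u, v, w) (a, c, b, u, w, v).
Proof.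
  intros P; pose proof (positive23_minors _ _ _ _ _ _ P) as (b0 & c0 & A0 & B0).
  destruct P as (a0 & C0 & D); unfold halfdisc in D.
  split; [unfold positive23, halfdisc; lia|].
  intros n (x & y & z & <-); exists x, z, y; unfold eval, adjoint; ring.
Qed.

(** The basis change e2 -> e2 + k e1 acts on the adjoint contragrediently, whence the witness
    [y + k * x]. *)
Lemma shear2 (a b c u v w k : Z) :
  sub_equiv (a, b, c, u, v, w) (a, b + k * w + k * k * a, c, u + k * v, v, w + 2 * k * a).
Proof.
  intros (a0 & C0 & D); unfold halfdisc in D.
  split; [unfold positive23, halfdisc; split; [|split]; [lia|lia|rewrite <- D; ring]|].
  intros n (x & y & z & <-); exists x, (y + k * x), z; unfold eval, adjoint; ring.
Qed.

Lemma shear3 (a b c u v w k l : Z) :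
  sub_equiv (a, b, c, u, v, w)
    (a, b, c + k * v + l * u + k * k * a + l * l * b + k * l * w,
     u + 2 * l * b + k * w, v + 2 * k * a + l * w, w).
Proof.
  intros (a0 & C0 & D); unfold halfdisc in D.
  split; [unfold positive23, halfdisc; split; [|split]; [lia|lia|rewrite <- D; ring]|].
  intros n (x & y & z & <-); exists x, y, (z + k * x + l * y); unfold eval, adjoint; ring.
Qed.

Lemma sub_equiv_trans (F G H : form) : sub_equiv F G -> sub_equiv G H -> sub_equiv F H.
Proof.
  intros FG GH P; destruct (FG P) as [PG RG]; destruct (GH PG) as [PH RH].
  split; [exact PH|intros n R; apply RH, RG, R].
Qed.

Definition trace (F : form) : Z := let '(a, b, c, u, v, w) := F in a + b + c.

Lemma sort_form (F : form) :
  exists a b c u v w, sub_equiv F (a, b, c, u, v, w) /\ a <= b <= c /\ trace F = a + b + c.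
Proof.
  assert (sort12 : exists a b c u v w,
            sub_equiv F (a, b, c, u, v, w) /\ a <= b /\ trace F = a + b + c).
  { destruct F as [[[[[a b] c] u] v] w]; cbn [trace]; destruct (Z_le_gt_dec a b).
    - exists a, b, c, u, v, w; split; [intros P; split; trivial|lia].
    - exists b, a, c, v, u, w; split; [apply swap12|lia]. }
  destruct sort12 as (a & b & c & u & v & w & E & ab & tr).
  destruct (Z_le_gt_dec b c).
  { exists a, b, c, u, v, w; split; [exact E|lia]. }
  pose proof (sub_equiv_trans _ _ _ E (swap23 a b c u v w)) as E1.
  destruct (Z_le_gt_dec a c).
  { exists a, c, b, u, w, v; split; [exact E1|lia]. }
  exists c, a, b, w, u, v.
  split; [exact (sub_equiv_trans _ _ _ E1 (swap12 _ _ _ _ _ _))|lia].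
Qed.

(** Minkowski reduction. A violated inequality names a swap or a shear that sorts F or lowers
    [trace]; the last four say that F(1, 1, 1), F(-1, 1, 1), F(1, -1, 1) and F(-1, -1, 1) are at
    least c. *)
Definition reduced (F : form) : Prop :=
  let '(a, b, c, u, v, w) := F in
  a <= b <= c /\ Z.abs w <= a /\ Z.abs v <= a /\ Z.abs u <= b /\
  0 <= a + b + u + v + w /\ 0 <= a + b + u - v - w /\
  0 <= a + b - u + v - w /\ 0 <= a + b - u - v + w.

Lemma reduce_form (F : form) :
  positive23 F -> exists G, sub_equiv F G /\ reduced G.
Proof.
  remember (Z.to_nat (trace F)) as m eqn:Em.
  revert F Em; induction m as [m IH] using (well_founded_induction Nat.lt_wf_0); intros F -> PF.
  destruct (sort_form F) as (a & b & c & u & v & w & FG & sorted & tr).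
  destruct (FG PF) as [PG _].
  assert (descend : forall H, sub_equiv (a, b, c, u, v, w) H -> trace H < trace F ->
                    exists G, sub_equiv F G /\ reduced G).
  { intros H GH lt; destruct (GH PG) as [PH _].
    pose proof (sub_equiv_trans _ _ _ FG GH) as FH.
    assert (0 < trace H).
    { destruct H as [[[[[a' b'] c'] u'] v'] w']; cbn [trace].
      pose proof (positive23_minors _ _ _ _ _ _ PH); destruct PH; lia. }
    destruct (IH (Z.to_nat (trace H))) with (F := H) as (G' & HG' & red); trivial; [lia|].
    exists G'; split; [exact (sub_equiv_trans _ _ _ FH HG')|exact red]. }
  rewrite tr in descend.
  destruct (Z_lt_ge_dec a w); [apply (descend _ (shear2 _ _ _ _ _ _ (-1))); cbn [trace]; lia|].
  destruct (Z_lt_ge_dec a (- w)); [apply (descend _ (shear2 _ _ _ _ _ _ 1)); cbn [trace]; lia|].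
  destruct (Z_lt_ge_dec a v); [apply (descend _ (shear3 _ _ _ _ _ _ (-1) 0)); cbn [trace]; lia|].
  destruct (Z_lt_ge_dec a (- v)); [apply (descend _ (shear3 _ _ _ _ _ _ 1 0)); cbn [trace]; lia|].
  destruct (Z_lt_ge_dec b u); [apply (descend _ (shear3 _ _ _ _ _ _ 0 (-1))); cbn [trace]; lia|].
  destruct (Z_lt_ge_dec b (- u)); [apply (descend _ (shear3 _ _ _ _ _ _ 0 1)); cbn [trace]; lia|].
  destruct (Z_lt_ge_dec (a + b + u + v + w) 0);
    [apply (descend _ (shear3 _ _ _ _ _ _ 1 1)); cbn [trace]; lia|].
  destruct (Z_lt_ge_dec (a + b + u - v - w) 0);
    [apply (descend _ (shear3 _ _ _ _ _ _ (-1) 1)); cbn [trace]; lia|].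
  destruct (Z_lt_ge_dec (a + b - u + v - w) 0);
    [apply (descend _ (shear3 _ _ _ _ _ _ 1 (-1))); cbn [trace]; lia|].
  destruct (Z_lt_ge_dec (a + b - u - v + w) 0);
    [apply (descend _ (shear3 _ _ _ _ _ _ (-1) (-1))); cbn [trace]; lia|].
  exists (a, b, c, u, v, w); split; [exact FG|].
  unfold reduced; lia.
Qed.

(** A weak form of the Gauss-Seeber inequality, which has half this bound. If u v w >= 0, each of a
    u^2, b v^2, c w^2 is at most a b c, and 4 - 3 = 1 copy remains. *)
Lemma reduced_bound (a b c u v w : Z) :
  0 < a -> halfdisc (a, b, c, u, v, w) = 23 -> reduced (a, b, c, u, v, w) ->
  a * b * c <= 23.
Proof.
  intros a0 D ((ab & bc) & Hw & Hv & Hu & S1 & S2 & S3 & S4); unfold halfdisc in D.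
  destruct (Z_le_gt_dec 0 (u * v * w)) as [pos|neg].
  - assert (sq : forall x m, Z.abs x <= m -> x * x <= m * m).
    { intros x m Hx; rewrite <- (Z.abs_square x); apply Z.square_le_mono_nonneg; lia. }
    apply sq in Hw, Hv, Hu.
    assert (b * b <= b * c) by nia.
    assert (a * a <= a * b) by nia.
    assert (a * b <= a * c) by nia.
    assert (a * (u * u) <= a * (b * c)) by nia.
    assert (b * (v * v) <= b * (a * c)) by nia.
    assert (c * (w * w) <= c * (a * b)) by nia.
    nia.
  (* For u v w < 0 one of the four sign conditions reads U + V + W <= a + b. Writing c W^2 = (c - b)
     W^2 + b W^2, the three squares cost at most a b (U + V + W) + (c - b) a b <= a^2 b + a b c;
     with U V W <= a^2 b, at least 3 a b c - 2 a^2 b >= a b c remains. *)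
  - set (U := Z.abs u) in *; set (V := Z.abs v) in *; set (W := Z.abs w) in *.
    assert (sum : U + V + W <= a + b).
    { destruct (Z_le_gt_dec 0 u), (Z_le_gt_dec 0 v), (Z_le_gt_dec 0 w);
        try (exfalso; nia); lia. }
    assert (E : U * V * W = - (u * v * w)).
    { unfold U, V, W; rewrite <- !Z.abs_mul, Z.abs_neq; lia. }
    assert (Eu : u * u = U * U) by (unfold U; lia).
    assert (Ev : v * v = V * V) by (unfold V; lia).
    assert (Ew : w * w = W * W) by (unfold W; lia).
    assert (U0 : 0 <= U) by apply Z.abs_nonneg.
    assert (V0 : 0 <= V) by apply Z.abs_nonneg.
    assert (W0 : 0 <= W) by apply Z.abs_nonneg.
    clearbody U V W.
    assert (D' : 4 * a * b * c - U * V * W - a * (U * U) - b * (V * V) - c * (W * W) = 23).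
    { rewrite E, <- Eu, <- Ev, <- Ew, <- D; ring. }
    assert (U * U <= b * U) by (apply Z.mul_le_mono_nonneg_r; lia).
    assert (V * V <= a * V) by (apply Z.mul_le_mono_nonneg_r; lia).
    assert (W * W <= a * W) by (apply Z.mul_le_mono_nonneg_r; lia).
    assert (W * W <= a * a) by (apply Z.mul_le_mono_nonneg; lia).
    assert (a * (U * U) <= a * (b * U)) by (apply Z.mul_le_mono_nonneg_l; lia).
    assert (b * (V * V) <= b * (a * V)) by (apply Z.mul_le_mono_nonneg_l; lia).
    assert (b * (W * W) <= b * (a * W)) by (apply Z.mul_le_mono_nonneg_l; lia).
    assert ((c - b) * (W * W) <= (c - b) * (a * a)) by (apply Z.mul_le_mono_nonneg_l; lia).
    assert (a * a <= a * b) by (apply Z.mul_le_mono_nonneg_l; lia).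
    assert ((c - b) * (a * a) <= (c - b) * (a * b)) by (apply Z.mul_le_mono_nonneg_l; lia).
    assert (V * W <= a * a) by (apply Z.mul_le_mono_nonneg; lia).
    assert (U * (V * W) <= b * (a * a))
      by (apply Z.mul_le_mono_nonneg; [lia|lia|apply Z.mul_nonneg_nonneg|]; lia).
    assert (0 <= a * b) by lia.
    assert (a * b * (U + V + W) <= a * b * (a + b)) by (apply Z.mul_le_mono_nonneg_l; lia).
    assert (a * b * a <= a * b * c) by (apply Z.mul_le_mono_nonneg_l; lia).
    lia.
Qed.

(** The matrix of an entry maps a vector to one at which the adjoint of the class representative
    takes the value that the adjoint of the first form has at the given vector. *)
Definition reduced_table : list (form * form * (Z * Z * Z * (Z * Z * Z) * (Z * Z * Z))) :=
 [((1, 1, 6, 0, -1, 0), formA, ((0, -1, 0), (-1, 0, 0), (-1, 0, -1)));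
 ((1, 1, 6, -1, 0, 0), formA, ((-1, 0, 0), (0, -1, 0), (0, -1, -1)));
 ((1, 1, 6, 1, 0, 0), formA, ((-1, 0, 0), (0, -1, 0), (0, -1, 1)));
 ((1, 1, 6, 0, 1, 0), formA, ((0, -1, 0), (-1, 0, 0), (-1, 0, 1)));
 ((1, 1, 8, 0, -1, -1), formC, ((-1, -1, 0), (-1, 0, 0), (-1, -1, -1)));
 ((1, 1, 8, 1, -1, -1), formC, ((-1, -1, 0), (-1, 0, 0), (0, -1, 1)));
 ((1, 1, 8, -1, 0, -1), formC, ((-1, -1, 0), (-1, 0, 0), (0, 0, 1)));
 ((1, 1, 8, 1, 0, -1), formC, ((-1, -1, 0), (-1, 0, 0), (0, 0, -1)));
 ((1, 1, 8, -1, 1, -1), formC, ((-1, -1, 0), (-1, 0, 0), (0, -1, -1)));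
 ((1, 1, 8, 0, 1, -1), formC, ((-1, -1, 0), (-1, 0, 0), (-1, -1, 1)));
 ((1, 1, 8, -1, -1, 1), formC, ((-1, 0, 0), (-1, 1, 0), (0, 0, 1)));
 ((1, 1, 8, 0, -1, 1), formC, ((-1, 0, 0), (-1, 1, 0), (-1, 0, -1)));
 ((1, 1, 8, -1, 0, 1), formC, ((-1, 0, 0), (-1, 1, 0), (0, -1, -1)));
 ((1, 1, 8, 1, 0, 1), formC, ((-1, 0, 0), (-1, 1, 0), (0, -1, 1)));
 ((1, 1, 8, 0, 1, 1), formC, ((-1, 0, 0), (-1, 1, 0), (-1, 0, 1)));
 ((1, 1, 8, 1, 1, 1), formC, ((-1, 0, 0), (-1, 1, 0), (0, 0, -1)));
 ((1, 2, 3, -1, 0, 0), formB, ((-1, 0, 0), (0, -1, 0), (0, 0, 1)));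
 ((1, 2, 3, 1, 0, 0), formB, ((-1, 0, 0), (0, -1, 0), (0, 0, -1)))].

Definition linear_image (M : Z * Z * Z * (Z * Z * Z) * (Z * Z * Z)) (x y z : Z) : Z * Z * Z :=
  let '((m11, m12, m13), (m21, m22, m23), (m31, m32, m33)) := M in
  (m11 * x + m12 * y + m13 * z, m21 * x + m22 * y + m23 * z, m31 * x + m32 * y + m33 * z).

Definition eval3 (F : form) (p : Z * Z * Z) : Z := let '(x, y, z) := p in eval F x y z.

(** By polarization a ternary quadratic form is determined by its values at these six vectors. *)
Definition certified (F G : form) (M : Z * Z * Z * (Z * Z * Z) * (Z * Z * Z)) : bool :=
  forallb (fun '(x, y, z) =>
             eval3 (adjoint G) (linear_image M x y z) =? eval (adjoint F) x y z)
    [(1, 0, 0); (0, 1, 0); (0, 0, 1); (0, 1, 1); (1, 0, 1); (1, 1, 0)].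

Definition eqb_form (F G : form) : bool :=
  let '(a, b, c, u, v, w) := F in let '(a', b', c', u', v', w') := G in
  (a =? a') && (b =? b') && (c =? c') && (u =? u') && (v =? v') && (w =? w').

Definition range (lo : Z) (k : nat) : list Z := map (fun i => lo + Z.of_nat i) (seq 0 k).

(** The ranges for a and b come from a^3 <= a b c <= 23 and b^2 <= a b c <= 23. *)
Definition small_forms : list form :=
  flat_map (fun a => flat_map (fun b => flat_map (fun c =>
  flat_map (fun u => flat_map (fun v => map (fun w => (a, b, c, u, v, w))
    (range (- a) (Z.to_nat (2 * a + 1)))) (range (- a) (Z.to_nat (2 * a + 1))))
    (range (- b) (Z.to_nat (2 * b + 1)))) (range b (Z.to_nat (23 / (a * b) + 1 - b))))
    (range a (Z.to_nat (5 - a)))) (range 1 2).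

Lemma small_forms_classified :
  forallb (fun F => if halfdisc F =? 23
                    then existsb (fun '(F', _, _) => eqb_form F F') reduced_table
                    else true) small_forms = true.
Proof. vm_compute; reflexivity. Qed.

Lemma reduced_table_certified :
  forallb (fun '(F, G, M) => certified F G M) reduced_table = true.
Proof. vm_compute; reflexivity. Qed.

Lemma eqb_formP (F G : form) : eqb_form F G = true -> F = G.
Proof.
  destruct F as [[[[[a b] c] u] v] w], G as [[[[[a' b'] c'] u'] v'] w'].
  unfold eqb_form; rewrite !andb_true_iff, !Z.eqb_eq.
  intros [[[[[-> ->] ->] ->] ->] ->]; reflexivity.
Qed.

Definition quadratic3 (g : Z -> Z -> Z -> Z) : Prop :=
  forall x y z,
  g x y z = x * x * g 1 0 0 + y * y * g 0 1 0 + z * z * g 0 0 1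
    + y * z * (g 0 1 1 - g 0 1 0 - g 0 0 1)
    + x * z * (g 1 0 1 - g 1 0 0 - g 0 0 1)
    + x * y * (g 1 1 0 - g 1 0 0 - g 0 1 0).

Lemma quadratic3_eval (F : form) : quadratic3 (eval F).
Proof. destruct F as [[[[[a b] c] u] v] w]; intros x y z; unfold eval; ring. Qed.

Lemma quadratic3_linear_image (F : form) M :
  quadratic3 (fun x y z => eval3 F (linear_image M x y z)).
Proof.
  destruct F as [[[[[a b] c] u] v] w], M as [[[[m11 m12] m13] [[m21 m22] m23]] [[m31 m32] m33]].
  intros x y z; unfold eval3, linear_image, eval; ring.
Qed.

Lemma certifiedP (F G : form) M n :
  certified F G M = true -> represents (adjoint F) n -> represents (adjoint G) n.
Proof.
  unfold certified; rewrite forallb_forall; intros cert (x & y & z & <-).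
  assert (E : eval3 (adjoint G) (linear_image M x y z) = eval (adjoint F) x y z).
  { rewrite (quadratic3_linear_image (adjoint G) M x y z), (quadratic3_eval (adjoint F) x y z).
    cbv beta.
    rewrite (proj1 (Z.eqb_eq _ _) (cert (1, 0, 0) ltac:(cbn [In]; tauto))),
      (proj1 (Z.eqb_eq _ _) (cert (0, 1, 0) ltac:(cbn [In]; tauto))),
      (proj1 (Z.eqb_eq _ _) (cert (0, 0, 1) ltac:(cbn [In]; tauto))),
      (proj1 (Z.eqb_eq _ _) (cert (0, 1, 1) ltac:(cbn [In]; tauto))),
      (proj1 (Z.eqb_eq _ _) (cert (1, 0, 1) ltac:(cbn [In]; tauto))),
      (proj1 (Z.eqb_eq _ _) (cert (1, 1, 0) ltac:(cbn [In]; tauto))).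
    reflexivity. }
  destruct (linear_image M x y z) as [[x' y'] z'].
  exists x', y', z'; exact E.
Qed.

Lemma in_range (lo x : Z) (k : nat) : lo <= x < lo + Z.of_nat k -> In x (range lo k).
Proof.
  intros Hx; apply in_map_iff; exists (Z.to_nat (x - lo)).
  split; [lia|apply in_seq; lia].
Qed.

Lemma positive23_represents (F : form) (n : Z) :
  positive23 F -> represents (adjoint F) n ->
  represents (adjoint formA) n \/ represents (adjoint formB) n \/ represents (adjoint formC) n.
Proof.
  intros PF RF.
  destruct (reduce_form F PF) as (G & FG & red); destruct (FG PF) as [PG RG].
  specialize (RG n RF); clear F PF RF FG.
  destruct G as [[[[[a b] c] u] v] w].
  pose proof (positive23_minors _ _ _ _ _ _ PG) as (b0 & c0 & _ & _).
  destruct PG as (a0 & _ & D).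
  pose proof (reduced_bound _ _ _ _ _ _ a0 D red) as abc.
  destruct red as ((ab & bc) & Hw & Hv & Hu & _).
  assert (a * b * b <= a * b * c) by (apply Z.mul_le_mono_nonneg_l; lia).
  assert (a * a * b <= a * b * b) by (replace (a * a * b) with (a * b * a) by ring;
    apply Z.mul_le_mono_nonneg_l; lia).
  assert (a * a * a <= a * a * b) by (apply Z.mul_le_mono_nonneg_l; lia).
  assert (a <= 2) by nia.
  assert (b * b <= a * b * b) by nia.
  assert (b <= 4) by nia.
  assert (1 * c <= a * b * c)
    by (apply Z.mul_le_mono_nonneg_r; [|apply Z.lt_pred_le, Z.mul_pos_pos]; lia).
  assert (Hin : In (a, b, c, u, v, w) small_forms).
  { unfold small_forms.
    apply in_flat_map; exists a; split; [apply in_range; lia|].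
    apply in_flat_map; exists b; split; [apply in_range; lia|].
    apply in_flat_map; exists c; split.
    { assert (c <= 23 / (a * b)) by (apply Z.div_le_lower_bound; lia).
      apply in_range; lia. }
    apply in_flat_map; exists u; split; [apply in_range; lia|].
    apply in_flat_map; exists v; split; [apply in_range; lia|].
    apply in_map; apply in_range; lia. }
  pose proof small_forms_classified as cl; rewrite forallb_forall in cl.
  specialize (cl _ Hin); cbv beta in cl.
  rewrite D in cl; cbn [Z.eqb Pos.eqb] in cl.
  apply existsb_exists in cl as ([[F' G] M] & Ht & EF).
  apply eqb_formP in EF; subst F'.
  pose proof reduced_table_certified as cert; rewrite forallb_forall in cert.
  specialize (cert _ Ht); cbv beta iota in cert.
  pose proof (certifiedP _ _ _ _ cert RG) as R.
  assert (HG : G = formA \/ G = formB \/ G = formC).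
  { clear -Ht; unfold reduced_table in Ht; cbn [In] in Ht.
    repeat (destruct Ht as [Ht|Ht];
            [apply (f_equal (fun t => snd (fst t))) in Ht; cbn [fst snd] in Ht; subst G; tauto|]).
    destruct Ht. }
  destruct HG as [-> | [-> | ->]]; tauto.
Qed.

(** * Transport of norms along 2-isogenies *)

Definition vec : Type := Z * Z * Z * Z.
Definition mat : Type := vec * vec * vec * vec.

(* Norm forms of the maximal orders A, B, C: with T the adjoint of [formA], [formB] or [formC], 4 q is (trace)^2 + T. *)
Definition qA (t : vec) : Z :=
  let '(a, b, c, d) := t in a * a + a * b + 6 * b * b + 6 * c * c - c * d + d * d.
Definition qB (t : vec) : Z :=
  let '(a, b, c, d) := t in a * a + a * b + 6 * b * b + 3 * c * c - c * d + 2 * d * d.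
Definition qC (t : vec) : Z :=
  let '(a, b, c, d) := t in
  a * a + a * (c + d) + 8 * b * b - 8 * b * c - b * d + 8 * c * c + c * d + d * d.
Definition trA (t : vec) : Z := let '(a, b, _, _) := t in 2 * a + b.
Definition trC (t : vec) : Z := let '(a, _, c, d) := t in 2 * a + c + d.

(* The norm form of Hom(A, C), a module of rank one over Z[i, omega]. *)
Definition qAC (t : vec) : Z :=
  let '(a, b, c, d) := t in
  3 * (a * a - a * b + b * b + c * c - c * d + d * d) + 2 * (b * c - a * d).

Definition vadd (u v : vec) : vec :=
  let '(a, b, c, d) := u in let '(a', b', c', d') := v in (a + a', b + b', c + c', d + d').
Definition vscale (k : Z) (v : vec) : vec :=
  let '(a, b, c, d) := v in (k * a, k * b, k * c, k * d).
Definition vmul (t : vec) (M : mat) : vec :=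
  let '(a, b, c, d) := t in let '(r0, r1, r2, r3) := M in
  vadd (vadd (vscale a r0) (vscale b r1)) (vadd (vscale c r2) (vscale d r3)).
(* Nested conditionals, because [&&] and [existsb] evaluate all their arguments under call by value. *)
Fixpoint find_divisor (m : Z) (t : vec) (L : list mat) : bool :=
  match L with
  | [] => false
  | M :: L' =>
      let '(a, b, c, d) := t in
      let '((e00, e01, e02, e03), (e10, e11, e12, e13),
            (e20, e21, e22, e23), (e30, e31, e32, e33)) := M in
      if (a * e00 + b * e10 + c * e20 + d * e30) mod m =? 0 then
      if (a * e01 + b * e11 + c * e21 + d * e31) mod m =? 0 then
      if (a * e02 + b * e12 + c * e22 + d * e32) mod m =? 0 then
      if (a * e03 + b * e13 + c * e23 + d * e33) mod m =? 0 then true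
      else find_divisor m t L' else find_divisor m t L'
      else find_divisor m t L' else find_divisor m t L'
  end.

(** Ten vectors whose values determine a quaternary quadratic form, so that a similitude is checked
    by finitely many evaluations. *)
Definition basis : list vec :=
  [(1,0,0,0); (0,1,0,0); (0,0,1,0); (0,0,0,1);
   (1,1,0,0); (1,0,1,0); (1,0,0,1); (0,1,1,0); (0,1,0,1); (0,0,1,1)].

Definition similitude (q : vec -> Z) (m : Z) (M : mat) : bool :=
  forallb (fun e => qAC (vmul e M) =? m * m * q e) basis.

Fixpoint similitudes (q : vec -> Z) (m : Z) (T : list (list mat)) : bool :=
  match T with
  | [] => true
  | L :: T' => forallb (similitude q m) L && similitudes q (2 * m) T'
  end.

Definition residues : list vec :=
  let b := [0; 1] in
  flat_map (fun x => flat_map (fun y => flat_map (fun z => map (fun w => (x, y, z, w)) b) b) b) b.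

(* Found by computing which classes modulo 64 no pair of isogenies of degree at most 2^6 covers.  Near s^2 = p and s^2 = p / 7 (note that 55 = 1 / 7 modulo 64) beta is 2-adically proportional to an element of norm 1 or 7, and these norms do not occur in Hom(A, C). *)
Definition admissible (p s : Z) : bool :=
  forallb (fun k => negb ((s * s - k * p) mod 64 =? 0)) [1; 31; 49; 55].

(** Divisibility of the image of t by 2m depends only on t modulo 2m, so one successful matrix
    settles a whole class. The search therefore runs down the tree of classes modulo 2, 4, ..., 64
    and splits only those still open. *)
Fixpoint covers (q tr : vec -> Z) (T : list (list mat)) (m : Z) (t : vec) : bool :=
  match T with
  | [] => negb (admissible (q t) (tr t))
  | L :: T' =>
      forallb
        (fun d =>
           let t' := vadd t (vscale m d) in
           if Z.even (tr t') then true else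
           if Z.even (q t') then true else
           if find_divisor (2 * m) t' L then true else
           covers q tr T' (2 * m) t')
        residues
  end.
(* The j-th list of each table contains matrices of beta |-> conj(gamma1) beta gamma2, or the same with conj(beta), for cyclic isogenies gamma1 and gamma2 of degree 2^j. *)
Definition tableA : list (list mat) :=
  [[];
   [];
   [((-3,2,1,-1),(-13,-10,-1,-7),(-2,4,-10,2),(1,2,-3,-5)); ((1,2,-3,-5),(-1,6,-13,-3),(10,12,2,6),(3,-2,-1,1));
    ((1,2,-3,-5),(2,-4,10,-2),(-10,-12,-2,-6),(-3,2,1,-1)); ((-3,2,1,-1),(10,12,2,6),(2,-4,10,-2),(-1,-2,3,5));
    ((1,2,-3,-5),(-1,6,-13,-3),(13,10,1,7),(-3,2,1,-1)); ((3,-2,-1,1),(13,10,1,7),(1,-6,13,3),(1,2,-3,-5));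
    ((3,-2,-1,1),(-10,-12,-2,-6),(-1,6,-13,-3),(-1,-2,3,5)); ((1,2,-3,-5),(2,-4,10,-2),(-13,-10,-1,-7),(3,-2,-1,1));
    ((1,4,-1,3),(10,8,-10,-2),(0,8,0,-8),(4,0,4,4)); ((1,4,-1,3),(-9,-4,9,5),(0,-8,0,8),(-4,0,-4,-4))];
   [((2,-3,8,11),(-18,3,8,5),(-20,-26,0,-6),(2,5,-8,3)); ((2,5,-8,3),(-18,-21,-8,-3),(20,-6,0,6),(-2,3,-8,-11));
    ((2,5,-8,3),(20,26,0,6),(-20,6,0,-6),(2,-3,8,11)); ((2,-3,8,11),(20,-6,0,6),(20,26,0,6),(-2,-5,8,-3));
    ((2,5,-8,3),(-18,-21,-8,-3),(18,-3,-8,-5),(2,-3,8,11)); ((-2,3,-8,-11),(18,-3,-8,-5),(18,21,8,3),(2,5,-8,3));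
    ((-2,3,-8,-11),(-20,6,0,-6),(-18,-21,-8,-3),(-2,-5,8,-3)); ((2,5,-8,3),(20,26,0,6),(-18,3,8,5),(-2,3,-8,-11));
    ((5,10,-1,-3),(1,18,-13,9),(-8,0,-24,-24),(-9,-2,5,-1)); ((-1,2,5,-5),(-13,-22,1,-17),(24,0,8,8),(-5,-6,9,7));
    ((-5,-6,9,7),(19,-6,17,15),(12,24,4,12),(1,-2,-5,5)); ((9,2,-5,1),(17,2,19,25),(-4,8,-12,12),(5,10,-1,-3));
    ((9,2,-5,1),(-8,0,-24,-24),(4,-8,12,-12),(-5,-10,1,3)); ((-5,-6,9,7),(-24,0,-8,-8),(-12,-24,-4,-12),(-1,2,5,-5));
    ((-1,2,5,-5),(12,24,4,12),(-24,0,-8,-8),(5,6,-9,-7)); ((5,10,-1,-3),(4,-8,12,-12),(8,0,24,24),(9,2,-5,1))];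
   [((7,-10,9,19),(15,-26,33,-5),(51,46,-3,15),(1,-6,-17,-11));
    ((-7,10,-9,-19),(-15,26,-33,5),(-52,-40,20,-4),(1,-6,-17,-11));
    ((-9,-14,17,15),(27,10,45,19),(40,16,-8,40),(-7,14,-1,1)); ((-17,-2,9,-5),(-45,-26,-27,-17),(-9,-50,33,3),(1,2,7,21));
    ((-7,10,-9,-19),(8,-16,24,-24),(52,40,-20,4),(-1,6,17,11)); ((7,-10,9,19),(-8,16,-24,24),(-51,-46,3,-15),(-1,6,17,11));
    ((17,2,-9,5),(-28,-24,-36,-12),(-8,-48,40,24),(-1,-2,-7,-21));
    ((-9,-14,17,15),(-36,-24,-28,-4),(-40,-16,8,-40),(7,-14,1,-1));
    ((-9,10,-7,-17),(-33,-38,-15,-41),(-20,-24,52,12),(17,6,-1,-7));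
    ((-9,10,-7,-17),(-33,-38,-15,-41),(-3,-18,51,5),(-17,-6,1,7)); ((-9,-14,17,15),(27,10,45,19),(33,30,-9,41),(7,-14,1,-1));
    ((17,2,-9,5),(45,26,27,17),(8,48,-40,-24),(1,2,7,21)); ((-9,10,-7,-17),(24,48,8,24),(3,18,-51,-5),(17,6,-1,-7));
    ((-9,10,-7,-17),(24,48,8,24),(20,24,-52,-12),(-17,-6,1,7)); ((-17,-2,9,-5),(28,24,36,12),(9,50,-33,-3),(-1,-2,-7,-21));
    ((-9,-14,17,15),(-36,-24,-28,-4),(-33,-30,9,-41),(-7,14,-1,1));
    ((1,-6,23,13),(34,-12,14,-6),(0,32,0,-32),(-18,-20,2,-10)); ((13,22,-13,-3),(10,12,-10,42),(24,-16,-24,-8),(14,4,18,14));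
    ((-23,-10,-1,-7),(-14,-20,-34,-46),(0,32,0,-32),(2,12,-18,2));
    ((13,10,-13,9),(10,52,-10,2),(-24,-16,24,40),(18,4,14,10));
    ((13,10,-13,9),(3,-42,-3,7),(24,16,-24,-40),(-18,-4,-14,-10));
    ((-23,-10,-1,-7),(-9,10,33,39),(0,-32,0,32),(-2,-12,18,-2));
    ((13,22,-13,-3),(3,10,-3,-45),(-24,16,24,8),(-14,-4,-18,-14)); ((1,-6,23,13),(-33,6,9,19),(0,-32,0,32),(18,20,-2,10))];
   [((17,14,35,13),(39,-62,69,75),(-15,-50,3,-83),(41,30,-21,5));
    ((35,22,17,3),(69,-6,39,101),(-3,-86,15,-35),(21,26,-41,-11));
    ((17,14,35,13),(-22,76,-34,-62),(-26,20,18,78),(41,30,-21,5));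
    ((-35,-22,-17,-3),(34,-28,22,98),(18,-60,-26,-46),(-21,-26,41,11));
    ((21,26,-41,-11),(3,86,-15,35),(69,-6,39,101),(-35,-22,-17,-3));
    ((-41,-30,21,-5),(-15,-50,3,-83),(-39,62,-69,-75),(17,14,35,13));
    ((-7,4,-5,31),(-61,44,-71,-59),(95,92,-51,9),(-5,12,33,13)); ((5,36,7,11),(71,12,61,105),(-51,-60,95,3),(33,20,-5,-17));
    ((-22,1,-40,-33),(6,87,-24,-55),(60,70,-48,58),(-36,-10,16,10));
    ((41,30,-21,5),(26,-20,-18,-78),(-22,76,-34,-62),(-17,-14,-35,-13));
    ((5,36,7,11),(-66,24,-54,-94),(18,40,-90,14),(33,20,-5,-17));
    ((7,-4,5,-31),(-54,40,-66,-90),(90,104,-18,22),(5,-12,-33,-13));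
    ((-29,-10,-13,-43),(-45,22,-93,-27),(68,8,-60,-36),(13,42,-3,-5));
    ((-22,-23,40,7),(-28,58,16,38),(60,-10,48,106),(-36,-26,-16,-6));
    ((21,26,-41,-11),(3,86,-15,35),(34,-28,22,98),(35,22,17,3));
    ((-22,1,-40,-33),(-28,-86,-16,22),(-60,-70,48,-58),(36,10,-16,-10));
    ((11,20,25,-3),(113,60,-5,39),(5,-84,87,51),(1,-4,-21,-41));
    ((-25,-28,-11,9),(-30,-72,102,62),(-66,-56,-6,-94),(-21,20,1,5));
    ((-41,-30,21,-5),(-26,20,18,78),(39,-62,69,75),(-17,-14,-35,-13));
    ((21,26,-41,-11),(18,-60,-26,-46),(-34,28,-22,-98),(-35,-22,-17,-3));
    ((-13,30,-29,-19),(80,96,16,48),(-63,-22,81,31),(3,-2,-13,29));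
    ((-22,-23,40,7),(6,-81,24,-31),(-60,10,-48,-106),(36,26,16,6));
    ((41,30,-21,5),(15,50,-3,83),(22,-76,34,62),(17,14,35,13));
    ((-11,-20,-25,3),(-113,-60,5,-39),(-6,88,-66,-10),(1,-4,-21,-41));
    ((-20,-39,18,-17),(-108,-25,-18,-47),(0,-16,-96,-48),(-8,-22,20,38));
    ((21,26,-41,-11),(18,-60,-26,-46),(-69,6,-39,-101),(35,22,17,3))]].

(** Modulo 2 the elements of B with odd trace and odd norm form two classes, (0, 1, 1, 0) and (1, 1,
    1, 0), each settled by one of these matrices. The empty lists bring the modulus up to 64. *)
Definition tableB : list (list mat) :=
  [[((-1,0,-1,-1),(-1,-2,-1,1),(1,2,-1,1),(1,0,-1,-1)); ((-1,0,-1,-1),(0,2,0,-2),(-1,-2,1,-1),(-1,0,1,1))]; []; []; []; []; []].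

Definition tableC : list (list mat) :=
  [[];
   [];
   [((-5,-4,1,-3),(-4,-8,4,12),(3,-4,-7,-11),(-4,0,-4,-4)); ((-2,-5,0,1),(12,2,8,14),(-2,3,-16,-7),(-4,-2,0,2));
    ((-2,3,0,1),(-12,-10,8,-6),(10,5,8,15),(2,5,0,-1)); ((1,4,-5,-1),(-4,8,4,-4),(-3,-4,-1,11),(5,4,-1,3));
    ((-1,-4,5,1),(3,-4,-7,-11),(0,8,8,0),(4,0,4,4)); ((2,-3,0,-1),(-2,3,-16,-7),(-8,-8,8,-8),(4,2,0,-2));
    ((-2,-5,0,1),(-12,-2,-8,-14),(0,-8,16,8),(2,-3,0,-1)); ((-5,-4,1,-3),(4,8,-4,-12),(-8,0,8,8),(-1,-4,5,1));
    ((1,4,-5,-1),(4,-8,-4,4),(4,8,-4,-12),(-4,0,-4,-4)); ((-2,3,0,1),(12,10,-8,6),(-12,-2,-8,-14),(-4,-2,0,2));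
    ((-2,-5,0,1),(8,8,-8,8),(-10,-5,-8,-15),(2,-3,0,-1)); ((2,-3,0,-1),(2,-3,16,7),(10,5,-8,7),(-2,-5,0,1));
    ((-1,-4,5,1),(-3,4,7,11),(-1,-12,-3,1),(-5,-4,1,-3)); ((-2,3,0,1),(-8,0,-8,-16),(-2,-5,16,9),(-4,-2,0,2));
    ((2,5,0,-1),(-2,-5,16,9),(12,10,-8,6),(4,2,0,-2)); ((-2,3,0,1),(8,0,8,16),(0,8,-16,-8),(2,5,0,-1))];
   [];
   [((-17,-2,-5,-19),(-10,-52,46,2),(-18,-4,-58,-22),(4,8,-12,-20));
    ((21,10,-7,-1),(6,44,-34,18),(22,12,46,2),(4,8,-12,-20)); ((7,6,-21,-11),(-58,-36,-18,-14),(46,44,-10,42),(12,-8,-4,4));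
    ((5,-14,17,15),(46,44,22,10),(-34,-52,6,-38),(12,-8,-4,4));
    ((-3,10,-1,13),(-24,-16,56,8),(-32,-32,-32,0),(-10,12,-14,-10));
    ((13,-10,7,9),(-32,-32,-32,0),(56,48,-24,-8),(14,4,10,22)); ((1,14,3,13),(56,48,-24,-8),(-24,-16,56,8),(-13,10,-7,-9));
    ((-7,2,-13,-23),(-32,-32,-32,0),(56,48,-24,-8),(3,-10,1,-13));
    ((7,6,-21,-11),(-34,-52,6,-38),(-12,8,-28,28),(-5,14,-17,-15));
    ((5,-14,17,15),(46,44,-10,42),(12,-8,28,-28),(-7,-6,21,11));
    ((-17,-2,-5,-19),(22,12,46,2),(-28,-56,-12,-20),(-21,-10,7,1));
    ((21,10,-7,-1),(-18,-4,-58,-22),(28,56,12,20),(17,2,5,19));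
    ((-1,-4,-15,-19),(38,56,-6,-14),(-45,-52,29,-23),(-16,0,-16,-16));
    ((1,14,3,13),(18,28,22,-22),(-42,-44,34,30),(14,4,10,22)); ((-7,2,-13,-23),(34,4,-42,2),(22,44,18,-10),(-10,12,-14,-10));
    ((-3,10,-1,13),(22,44,18,-10),(-56,-48,24,8),(7,-2,13,23));
    ((13,-10,7,9),(-42,-44,34,30),(24,16,-56,-8),(-1,-14,-3,-13)); ((-15,4,-1,3),(6,-8,-38,18),(23,60,-7,-11),(1,4,15,19));
    ((15,-4,1,-3),(-45,-52,29,-23),(22,-8,-22,34),(16,0,16,16)); ((-1,-4,-15,-19),(-38,-56,6,14),(44,48,-44,4),(15,-4,1,-3));
    ((-15,4,-1,3),(-6,8,38,-18),(-38,-56,6,14),(-16,0,-16,-16)); ((15,-4,1,-3),(45,52,-29,23),(-7,4,23,-37),(-1,-4,-15,-19));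
    ((1,14,3,13),(-56,-48,24,8),(25,30,-53,5),(14,4,10,22)); ((-5,14,-17,-15),(19,-2,7,-39),(-58,-36,-18,-14),(-12,8,4,-4));
    ((-7,-6,21,11),(-7,-6,-11,43),(46,44,22,10),(-12,8,4,-4));
    ((-7,2,-13,-23),(32,32,32,0),(-63,-46,11,-15),(-10,12,-14,-10));
    ((-21,-10,7,1),(11,54,7,1),(-10,-52,46,2),(-4,-8,12,20)); ((17,2,5,19),(-7,-46,-19,-21),(6,44,-34,18),(-4,-8,12,20));
    ((-3,10,-1,13),(24,16,-56,-8),(29,42,31,13),(7,-2,13,23)); ((13,-10,7,9),(32,32,32,0),(-43,-58,31,17),(-1,-14,-3,-13));
    ((7,6,-21,-11),(58,36,18,14),(-39,-38,-11,-53),(-5,14,-17,-15));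
    ((5,-14,17,15),(-46,-44,-22,-10),(39,38,11,53),(-7,-6,21,11)); ((-17,-2,-5,-19),(10,52,-46,-2),(1,2,53,3),(-21,-10,7,1));
    ((21,10,-7,-1),(-6,-44,34,-18),(-1,-2,-53,-3),(17,2,5,19));
    ((-3,10,-1,13),(-22,-44,-18,10),(53,58,-25,5),(-10,12,-14,-10));
    ((13,-10,7,9),(42,44,-34,-30),(-11,-26,63,17),(14,4,10,22));
    ((1,14,3,13),(-18,-28,-22,22),(43,58,-31,-17),(-13,10,-7,-9));
    ((-13,10,-7,-9),(-25,-30,53,-5),(-31,-18,-29,13),(1,14,3,13));
    ((3,-10,1,-13),(-63,-46,11,-15),(34,4,-42,2),(10,-12,14,10));
    ((-13,10,-7,-9),(25,30,-53,5),(18,28,22,-22),(-14,-4,-10,-22));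
    ((3,-10,1,-13),(63,46,-11,15),(-31,-14,43,-15),(-7,2,-13,-23));
    ((-7,2,-13,-23),(-34,-4,42,-2),(-29,-42,-31,-13),(3,-10,1,-13))];
   [((-27,10,-7,-33),(12,88,-68,36),(-83,-102,-31,-73),(8,16,-24,-40));
    ((17,10,-35,-29),(92,88,44,20),(-7,26,-91,27),(24,-16,-8,8));
    ((30,19,-16,-23),(96,16,64,112),(-50,-21,48,-79),(14,43,-16,-15));
    ((15,28,-43,-15),(-24,-32,-8,88),(-17,92,-11,-47),(-25,-4,-35,-39));
    ((7,-26,27,37),(-68,-104,12,-76),(99,62,71,57),(-17,-10,35,29));
    ((-17,-4,-7,-43),(-46,8,94,38),(-45,-116,-11,-31),(-32,0,-32,-32));
    ((-15,4,-25,11),(74,104,-90,-50),(-61,12,69,49),(17,4,7,43));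
    ((-14,-43,16,15),(-80,-40,64,-56),(-30,-19,-112,-41),(16,-24,0,-8));
    ((30,11,16,-7),(-96,-80,64,-48),(46,51,-112,-79),(16,40,0,-8));
    ((-14,29,-16,-1),(80,40,64,120),(-110,-51,48,-49),(-30,-11,-16,7));
    ((15,-4,25,-11),(-45,-116,-11,-31),(106,104,-58,-18),(32,0,32,32));
    ((-15,4,-25,11),(-74,-104,90,50),(46,-8,-94,-38),(-32,0,-32,-32));
    ((35,-4,25,21),(-32,-64,32,96),(43,92,49,13),(43,28,-15,13));
    ((-6,-35,8,23),(-96,-80,64,-48),(10,5,-120,-49),(26,-19,8,7));
    ((-26,-45,8,1),(-16,24,-128,-56),(70,-29,72,113),(6,-29,8,-15));
    ((-35,-6,17,7),(-83,-102,-31,-73),(36,8,116,44),(-8,-16,24,40));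
    ((30,19,-16,-23),(-96,-16,-64,-112),(80,40,-64,56),(16,-24,0,-8));
    ((-6,29,-8,15),(96,16,64,112),(-86,-11,56,-41),(-32,-16,0,16));
    ((-13,-20,-19,-39),(44,112,-44,-60),(31,-36,-63,29),(19,-20,13,-7));
    ((-7,26,-27,-37),(-7,26,-91,27),(-92,-88,20,-84),(-24,16,8,-8));
    ((25,4,35,39),(-32,64,32,-32),(81,-28,11,-17),(40,32,-8,24));
    ((-26,19,-8,-7),(16,40,-128,-72),(54,59,56,113),(-32,-16,0,16));
    ((7,-26,27,37),(68,104,-12,76),(-92,-88,-44,-20),(24,-16,-8,8));
    ((-23,10,-35,-13),(14,-20,38,122),(41,10,-99,-77),(14,44,-26,-6));
    ((9,2,37,3),(-26,-84,78,98),(73,2,-27,-61),(-26,-20,14,-30));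
    ((-35,-22,-23,-33),(-38,84,-14,-34),(-61,-106,55,65),(-9,-2,-37,-3));
    ((9,2,37,3),(26,84,-78,-98),(-64,0,64,64),(35,22,23,33));
    ((-19,20,-13,7),(44,-16,-44,68),(-107,-76,75,-1),(-32,0,-32,-32));
    ((35,22,23,33),(73,2,-27,-61),(-12,104,-28,-4),(26,20,-14,30));
    ((-35,-22,-23,-33),(38,-84,14,34),(26,84,-78,-98),(-26,-20,14,-30));
    ((37,34,9,7),(78,-20,-26,58),(-14,20,-38,-122),(14,44,-26,-6));
    ((-37,-34,-9,-7),(41,10,-99,-77),(-92,-24,52,-52),(-14,-44,26,6));
    ((-23,10,-35,-13),(-14,20,-38,-122),(-64,0,64,64),(-37,-34,-9,-7));
    ((35,22,23,33),(-73,-2,27,61),(47,-82,51,37),(9,2,37,3)); ((37,34,9,7),(-78,20,26,-58),(51,14,47,129),(23,-10,35,13));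
    ((-37,-34,-9,-7),(-41,-10,99,77),(55,-10,-61,45),(-23,10,-35,-13));
    ((30,11,16,-7),(96,80,-64,48),(-16,-40,128,72),(14,-29,16,1));
    ((-30,-19,16,23),(30,19,112,41),(-110,-59,-48,-97),(-14,-43,16,15));
    ((-43,-28,15,-13),(-8,-96,-24,8),(-24,32,56,88),(-35,4,-25,-21));
    ((-15,-28,43,15),(-81,28,-11,17),(49,36,43,-49),(25,4,35,39));
    ((-17,-4,-7,-43),(46,-8,-94,-38),(28,112,4,-12),(15,-4,25,-11));
    ((15,-4,25,-11),(45,116,11,31),(-91,-108,83,7),(-17,-4,-7,-43))]].

Definition quadratic (q : vec -> Z) : Prop :=
  forall a b c d,
  q (a, b, c, d) =
    a * a * q (1,0,0,0) + b * b * q (0,1,0,0) + c * c * q (0,0,1,0) + d * d * q (0,0,0,1)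
  + a * b * (q (1,1,0,0) - q (1,0,0,0) - q (0,1,0,0))
  + a * c * (q (1,0,1,0) - q (1,0,0,0) - q (0,0,1,0))
  + a * d * (q (1,0,0,1) - q (1,0,0,0) - q (0,0,0,1))
  + b * c * (q (0,1,1,0) - q (0,1,0,0) - q (0,0,1,0))
  + b * d * (q (0,1,0,1) - q (0,1,0,0) - q (0,0,0,1))
  + c * d * (q (0,0,1,1) - q (0,0,1,0) - q (0,0,0,1)).

Lemma quadratic_qA : quadratic qA. Proof. intros a b c d; unfold qA, qB, qC; ring. Qed.
Lemma quadratic_qB : quadratic qB. Proof. intros a b c d; unfold qA, qB, qC; ring. Qed.
Lemma quadratic_qC : quadratic qC. Proof. intros a b c d; unfold qA, qB, qC; ring. Qed.

Lemma quadratic_qAC_vmul (M : mat) : quadratic (fun t => qAC (vmul t M)).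
Proof.
  destruct M as [[[[[[? ?] ?] ?] [[[? ?] ?] ?]] [[[? ?] ?] ?]] [[[? ?] ?] ?]].
  intros a b c d.
  cbn [vmul vadd vscale]. unfold qAC.
  ring.
Qed.

Lemma similitudeP (q : vec -> Z) (m : Z) (M : mat) :
  quadratic q -> similitude q m M = true -> forall t, qAC (vmul t M) = m * m * q t.
Proof.
  intros quad sim [[[a b] c] d].
  unfold similitude in sim; rewrite forallb_forall in sim.
  assert (E : forall e, In e basis -> qAC (vmul e M) = m * m * q e)
    by (intros e He; apply Z.eqb_eq, sim, He).
  rewrite (quadratic_qAC_vmul M a b c d), (quad a b c d); cbv beta.
  rewrite !E by (cbv [basis In]; tauto).
  ring.
Qed.

Lemma qAC_vscale (k : Z) (v : vec) : qAC (vscale k v) = k * k * qAC v.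
Proof. destruct v as [[[a b] c] d]; cbn -[Z.mul Z.add Z.sub]; ring. Qed.

Lemma find_divisorP (m : Z) (t : vec) (L : list mat) :
  m <> 0 -> find_divisor m t L = true ->
  exists M v, In M L /\ vmul t M = vscale m v.
Proof.
  intros m0; induction L as [|M L IH]; [discriminate|].
  destruct t as [[[a b] c] d].
  destruct M as [[[[[[e00 e01] e02] e03] [[[e10 e11] e12] e13]] [[[e20 e21] e22] e23]]
                 [[[e30 e31] e32] e33]].
  cbn [find_divisor].
  assert (skip : find_divisor m (a, b, c, d) L = true ->
    exists M v, In M (((e00, e01, e02, e03), (e10, e11, e12, e13),
            (e20, e21, e22, e23), (e30, e31, e32, e33)) :: L)
       /\ vmul (a, b, c, d) M = vscale m v).
  { intros H; destruct (IH H) as (M & v & HM & Hv); exists M, v; split; [right|]; assumption. }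
  do 4 (match goal with
  | |- (if ?x mod m =? 0 then _ else _) = true -> _ =>
      let E := fresh "E" in
      destruct (Z.eqb_spec (x mod m) 0) as [E|_]; [|exact skip];
      apply (Z.div_exact _ _ m0) in E
  end).
  intros _; eexists (_, _, _, _), (_, _, _, _).
  split; [left; reflexivity|].
  cbn [vmul vadd vscale].
  rewrite <- ?Z.add_assoc in *.
  rewrite E, E0, E1, E2 at 1; reflexivity.
Qed.

Definition congruent (q : vec -> Z) : Prop :=
  forall m r e, exists k, q (vadd r (vscale m e)) = q r + m * k.

Lemma quadratic_congruent (q : vec -> Z) : quadratic q -> congruent q.
Proof.
  intros quad m r e.
  exists (q (vadd r e) - q r - q e + m * q e).
  destruct r as [[[a b] c] d], e as [[[a' b'] c'] d']; cbn -[Z.mul Z.add Z.sub].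
  rewrite (quad (a + m * a') (b + m * b') (c + m * c') (d + m * d')), (quad a b c d),
    (quad a' b' c' d'), (quad (a + a') (b + b') (c + c') (d + d')).
  ring.
Qed.

Ltac vec_ring := do 3 (apply f_equal2; [|ring]); ring.

Lemma residues_complete (e : vec) :
  exists d e', In d residues /\ e = vadd d (vscale 2 e').
Proof.
  destruct e as [[[a b] c] d].
  exists (a mod 2, b mod 2, c mod 2, d mod 2), (a / 2, b / 2, c / 2, d / 2); split.
  - assert (E : forall x, x mod 2 = 0 \/ x mod 2 = 1)
      by (intros x; pose proof (Z.mod_pos_bound x 2); lia).
    destruct (E a) as [-> | ->], (E b) as [-> | ->], (E c) as [-> | ->], (E d) as [-> | ->];
      vm_compute; tauto.
  - cbn [vadd vscale].
    do 3 (apply f_equal2; [|rewrite Z.add_comm; apply Z.div_mod; lia]).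
    rewrite Z.add_comm; apply Z.div_mod; lia.
Qed.

Lemma admissible_mod64 (p s k l : Z) :
  admissible (p + 64 * k) (s + 64 * l) = admissible p s.
Proof.
  unfold admissible; cbn [forallb].
  assert (E : forall c, ((s + 64 * l) * (s + 64 * l) - c * (p + 64 * k)) mod 64
                        = (s * s - c * p) mod 64).
  { intros c.
    replace ((s + 64 * l) * (s + 64 * l) - c * (p + 64 * k))
      with (s * s - c * p + (2 * s * l + 64 * l * l - c * k) * 64) by ring.
    apply Z.mod_add; lia. }
  rewrite !E; reflexivity.
Qed.

Lemma coversP (q tr : vec -> Z) :
  quadratic q -> congruent tr ->
  forall T m r, 0 < m -> (64 | m * 2 ^ Z.of_nat (length T)) ->
  similitudes q (2 * m) T = true -> covers q tr T m r = true ->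
  forall e, let t := vadd r (vscale m e) in
  Z.odd (tr t) = true -> Z.odd (q t) = true -> admissible (q t) (tr t) = true ->
  exists v, qAC v = q t.
Proof.
  intros quad ctr; pose proof (quadratic_congruent _ quad) as cq.
  induction T as [|L T IH]; intros m r m0 div64 sim cov e t odd_tr odd_q adm.
  (* When the lists are exhausted the modulus is a multiple of 64, so [admissible] is constant on
     the class, and [cov] says that it fails there. *)
  - exfalso; cbn [covers] in cov; destruct div64 as [z Hz].
    assert (Em : m = 64 * z) by (cbn in Hz; lia).
    destruct (cq m r e) as [k Hk], (ctr m r e) as [l Hl]; fold t in Hk, Hl.
    rewrite Hk, Hl, Em, <- !Z.mul_assoc, admissible_mod64 in adm.
    rewrite adm in cov; discriminate.
  - cbn [similitudes] in sim; apply andb_true_iff in sim as [simL simT].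
    cbn [covers] in cov; rewrite forallb_forall in cov.
    destruct (residues_complete e) as (d & e' & Hd & Ee).
    specialize (cov d Hd); cbv beta zeta in cov.
    assert (Et : t = vadd (vadd r (vscale m d)) (vscale (2 * m) e')).
    { unfold t; rewrite Ee.
      destruct r as [[[? ?] ?] ?], d as [[[? ?] ?] ?], e' as [[[? ?] ?] ?].
      cbn [vadd vscale]; vec_ring. }
    set (t' := vadd r (vscale m d)) in *.
    assert (even_step : forall g, congruent g -> Z.even (g t') = true -> Z.odd (g t) = false).
    { intros g cg ev; destruct (cg (2 * m) t' e') as [k Hk].
      rewrite Et, Hk, <- Z.mul_assoc, Z.odd_add_mul_2, <- Z.negb_even, ev.
      reflexivity. }
    destruct (Z.even (tr t')) eqn:Etr.
    { rewrite (even_step tr ctr Etr) in odd_tr; discriminate. }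
    destruct (Z.even (q t')) eqn:Eq.
    { rewrite (even_step q cq Eq) in odd_q; discriminate. }
    destruct (find_divisor (2 * m) t' L) eqn:Ef.
    + apply find_divisorP in Ef as (M & v & HM & Hv); [|lia].
      rewrite forallb_forall in simL.
      pose proof (similitudeP _ _ _ quad (simL M HM) t) as simM.
      exists (vadd v (vmul e' M)).
      assert (Hm : vmul t M = vscale (2 * m) (vadd v (vmul e' M))).
      { transitivity (vadd (vmul t' M) (vscale (2 * m) (vmul e' M))).
        - rewrite Et; clear.
          destruct t' as [[[? ?] ?] ?], e' as [[[? ?] ?] ?],
            M as [[[[[[? ?] ?] ?] [[[? ?] ?] ?]] [[[? ?] ?] ?]] [[[? ?] ?] ?]].
          cbn [vmul vadd vscale]; vec_ring.
        - rewrite Hv; clear.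
          destruct (vmul e' M) as [[[? ?] ?] ?], v as [[[? ?] ?] ?].
          cbn [vadd vscale]; vec_ring. }
      rewrite Hm, qAC_vscale in simM.
      apply (Z.mul_reg_l _ _ (2 * m * (2 * m))); [nia|exact simM].
    + rewrite Et in odd_tr, odd_q, adm |- *.
      apply (IH (2 * m) t'); trivial; [lia| ].
      cbn [length] in div64; rewrite Nat2Z.inj_succ, Z.pow_succ_r in div64 by lia.
      replace (2 * m * 2 ^ Z.of_nat (length T)) with (m * (2 * 2 ^ Z.of_nat (length T))) by ring.
      exact div64.
Qed.

Lemma congruent_trA : congruent trA.
Proof.
  intros m [[[a b] c] d] [[[a' b'] c'] d']; exists (trA (a', b', c', d')).
  unfold trA; cbn [vadd vscale]; ring.
Qed.

Lemma congruent_trC : congruent trC.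
Proof.
  intros m [[[a b] c] d] [[[a' b'] c'] d']; exists (trC (a', b', c', d')).
  unfold trC; cbn [vadd vscale]; ring.
Qed.

Lemma covers_sound (q tr : vec -> Z) (T : list (list mat)) :
  quadratic q -> congruent tr -> (64 | 2 ^ Z.of_nat (length T)) ->
  similitudes q 2 T = true -> covers q tr T 1 (0, 0, 0, 0) = true ->
  forall t, Z.odd (tr t) = true -> Z.odd (q t) = true ->
  admissible (q t) (tr t) = true -> exists v, qAC v = q t.
Proof.
  intros quad ctr div64 sim cov t odd_tr odd_q adm.
  assert (Et : t = vadd (0, 0, 0, 0) (vscale 1 t)).
  { destruct t as [[[a b] c] d]; cbn [vadd vscale]; vec_ring. }
  rewrite Et in odd_tr, odd_q, adm |- *.
  apply (coversP q tr quad ctr T 1 (0, 0, 0, 0)); trivial; [lia|].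
  rewrite Z.mul_1_l; exact div64.
Qed.

Lemma sound_A (t : vec) :
  Z.odd (trA t) = true -> Z.odd (qA t) = true -> admissible (qA t) (trA t) = true ->
  exists v, qAC v = qA t.
Proof.
  apply (covers_sound qA trA tableA quadratic_qA congruent_trA).
  - exists 1; reflexivity.
  - vm_compute; reflexivity.
  - vm_compute; reflexivity.
Qed.

Lemma sound_B (t : vec) :
  Z.odd (trA t) = true -> Z.odd (qB t) = true -> admissible (qB t) (trA t) = true ->
  exists v, qAC v = qB t.
Proof.
  apply (covers_sound qB trA tableB quadratic_qB congruent_trA).
  - exists 1; reflexivity.
  - vm_compute; reflexivity.
  - vm_compute; reflexivity.
Qed.

Lemma sound_C (t : vec) :
  Z.odd (trC t) = true -> Z.odd (qC t) = true -> admissible (qC t) (trC t) = true ->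
  exists v, qAC v = qC t.
Proof.
  apply (covers_sound qC trC tableC quadratic_qC congruent_trC).
  - exists 1; reflexivity.
  - vm_compute; reflexivity.
  - vm_compute; reflexivity.
Qed.

(** * Sums of two values of f, and the choice of the trace *)

Definition bform (x y : Z) : Z := 3 * x * x + 2 * x * y + 8 * y * y.

Lemma qAC_even_coords (a b c d : Z) :
  exists x y z w, bform x y + bform z w = qAC (a, 2 * b, c, 2 * d).
Proof.
  exists (d + b - a), (- d), (c - d + b), (- b); unfold bform, qAC; ring.
Qed.

(* Multiplication by a cube root of unity: its powers permute the three sublattices that cover the vectors of odd norm. *)
Lemma qAC_rotate (a b c d : Z) : qAC (- b, a - b, - d, c - d) = qAC (a, b, c, d).
Proof. unfold qAC; ring. Qed.

(** Modulo 2 the norm is the sum of the values of x^2 + xy + y^2 at (a, b) and (c, d), which vanish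
    only at even pairs. So an odd norm means exactly one nonzero pair modulo 2; the rotation
    permutes the three nonzero pairs cyclically and brings it to (1, 0). *)
Lemma odd_qAC_sum_bform (v : vec) :
  Z.odd (qAC v) = true -> exists x y z w, bform x y + bform z w = qAC v.
Proof.
  destruct v as [[[a b] c] d]; intros odd_q.
  assert (base : forall a b c d, Z.even b = true -> Z.even d = true ->
    exists x y z w, bform x y + bform z w = qAC (a, b, c, d)).
  { intros a' b' c' d' Hb Hd.
    apply Z.even_spec in Hb as [b2 ->]; apply Z.even_spec in Hd as [d2 ->].
    apply qAC_even_coords. }
  unfold qAC in odd_q.
  repeat rewrite ?Z.odd_add, ?Z.odd_mul, ?Z.odd_sub in odd_q.
  destruct (Z.odd b) eqn:Ob, (Z.odd d) eqn:Od.
  1,2,3: rewrite <- qAC_rotate.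
  4: apply base; rewrite <- Z.negb_odd; [rewrite Ob|rewrite Od]; reflexivity.
  all: destruct (Z.odd a) eqn:Oa, (Z.odd c) eqn:Oc; try discriminate odd_q.
  all: try (apply base; rewrite <- Z.negb_odd, Z.odd_sub, ?Oa, ?Ob, ?Oc, ?Od; reflexivity).
  all: rewrite <- qAC_rotate; apply base;
    rewrite <- Z.negb_odd, ?Z.odd_sub, ?Z.odd_opp, ?Oa, ?Ob, ?Oc, ?Od; try reflexivity.
Qed.

Lemma ternary_sum_bform (p s a b c u w : Z) :
  Z.odd p = true -> Z.odd s = true -> admissible p s = true -> s * s < 4 * p -> 0 < a ->
  w * w + (4 * p - s * s) = 4 * a * b -> (4 * p - s * s) * c = a * u * u + 23 ->
  exists x y z t, bform x y + bform z t = p.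
Proof.
  intros odd_p odd_s adm lt a0 Eb Ec.
  set (n := 4 * p - s * s) in *.
  assert (odd_n : Z.odd n = true).
  { unfold n; rewrite Z.odd_sub, !Z.odd_mul, odd_s; reflexivity. }
  (* With v = 0 the half-discriminant is (4ab - w^2) c - a u^2 = n c - a u^2, so the two equations
     say that the binary form a x^2 + w xy + b y^2 extends. *)
  assert (P : positive23 (a, b, c, u, 0, w)).
  { unfold positive23, halfdisc; split; [|split]; [lia|lia|].
    replace (4 * a * b * c) with ((w * w + n) * c) by (rewrite Eb; ring).
    replace ((w * w + n) * c) with (c * w * w + n * c) by ring.
    rewrite Ec; ring. }
  assert (R : represents (adjoint (a, b, c, u, 0, w)) n).
  { exists 0, 0, 1; unfold eval, adjoint; lia. }
  assert (H : exists v, qAC v = p).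
  { assert (conclude : forall q tr : vec -> Z,
      (forall t, Z.odd (tr t) = true -> Z.odd (q t) = true ->
         admissible (q t) (tr t) = true -> exists v, qAC v = q t) ->
      forall t, tr t = s -> q t = p -> exists v, qAC v = p).
    { intros q tr sound t Es Ep; rewrite <- Ep; apply sound; rewrite ?Es, ?Ep; assumption. }
    destruct (positive23_represents _ n P R) as [(x & y & z & E) | [(x & y & z & E) | (x & y & z & E)]];
      unfold eval, adjoint, formA, formB, formC in E; cbn -[Z.mul Z.add Z.sub] in E.
    (* The adjoint of [formA] is congruent to x^2 modulo 2, so x is odd like s. Hence s = 2h + x has
       a solution h, and the norm is (s^2 + n) / 4 = p. *)
    - assert (Hx : Z.odd (s - x) = false).
      { rewrite <- E in odd_n.
        repeat rewrite ?Z.odd_add, ?Z.odd_mul, ?Z.odd_sub in odd_n.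
        rewrite Z.odd_sub, odd_s; destruct (Z.odd x), (Z.odd y), (Z.odd z); trivial; discriminate. }
      rewrite <- Z.negb_even in Hx; apply negb_false_iff, Z.even_spec in Hx as [h Hh].
      apply (conclude qA trA sound_A (h, x, y, z)); unfold trA, qA; [lia|].
      assert (Es : s = x + 2 * h) by lia; unfold n in E; rewrite Es in E; lia.
    - assert (Hx : Z.odd (s - x) = false).
      { rewrite <- E in odd_n.
        repeat rewrite ?Z.odd_add, ?Z.odd_mul, ?Z.odd_sub in odd_n.
        rewrite Z.odd_sub, odd_s; destruct (Z.odd x), (Z.odd y), (Z.odd z); trivial; discriminate. }
      rewrite <- Z.negb_even in Hx; apply negb_false_iff, Z.even_spec in Hx as [h Hh].
      apply (conclude qB trA sound_B (h, x, y, z)); unfold trA, qB; [lia|].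
      assert (Es : s = x + 2 * h) by lia; unfold n in E; rewrite Es in E; lia.
    - assert (Hx : Z.odd (s - (y + z)) = false).
      { rewrite <- E in odd_n.
        repeat rewrite ?Z.odd_add, ?Z.odd_mul, ?Z.odd_sub in odd_n.
        rewrite Z.odd_sub, Z.odd_add, odd_s;
          destruct (Z.odd x), (Z.odd y), (Z.odd z); trivial; discriminate. }
      rewrite <- Z.negb_even in Hx; apply negb_false_iff, Z.even_spec in Hx as [h Hh].
      apply (conclude qC trC sound_C (h, x, y, z)); unfold trC, qC; [lia|].
      assert (Es : s = y + z + 2 * h) by lia; unfold n in E; rewrite Es in E; lia. }
  destruct H as [v <-]; apply odd_qAC_sum_bform, odd_p.
Qed.

(* It depends on p only modulo 1472 = 64 * 23. *)
Definition good_trace (p s : Z) : bool :=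
  Z.odd s && admissible p s && ((4 * p - s * s) mod 8 =? 3) &&
  existsb (fun m => (4 * p - s * s - m * m) mod 23 =? 0) (range 1 11).

Lemma good_trace_mod (p k s : Z) : good_trace (p + 1472 * k) s = good_trace p s.
Proof.
  unfold good_trace; f_equal; [f_equal; [f_equal|]|].
  - replace (1472 * k) with (64 * (23 * k)) by ring.
    rewrite <- (admissible_mod64 p s (23 * k) 0); f_equal; lia.
  - f_equal; rewrite <- (Z.mod_add (4 * p - s * s) (736 * k) 8) by lia; f_equal; lia.
  - assert (E : forall m, (4 * (p + 1472 * k) - s * s - m * m) mod 23
                          = (4 * p - s * s - m * m) mod 23).
    { intros m; rewrite <- (Z.mod_add (4 * p - s * s - m * m) (256 * k) 23) by lia; f_equal; lia. }
    induction (range 1 11) as [|m l IH]; [reflexivity|].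
    cbn [existsb]; rewrite E, IH; reflexivity.
Qed.

Lemma good_trace_residues :
  forallb (fun p => if Z.even p then true else if p mod 23 =? 0 then true
                    else existsb (good_trace p) [1; 3; 5; 7; 9; 11; 13; 15; 17])
    (range 0 (Z.to_nat 1472)) = true.
Proof. vm_compute; reflexivity. Qed.

Lemma exists_good_trace (p : Z) :
  Z.odd p = true -> p mod 23 <> 0 -> 73 <= p ->
  exists s, good_trace p s = true /\ s * s < 4 * p.
Proof.
  intros odd_p p23 p73.
  set (r := p mod 1472); set (k := p / 1472).
  assert (Ep : p = r + 1472 * k) by (unfold r, k; rewrite Z.add_comm; apply Z.div_mod; lia).
  assert (Hr : 0 <= r < 1472) by (apply Z.mod_pos_bound; lia).
  pose proof good_trace_residues as all; rewrite forallb_forall in all.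
  specialize (all r (in_range 0 r (Z.to_nat 1472) ltac:(lia))); cbv beta in all.
  rewrite <- Z.negb_odd in all.
  assert (Or : Z.odd r = true).
  { rewrite Ep in odd_p; replace (1472 * k) with (2 * (736 * k)) in odd_p by ring.
    rewrite Z.odd_add_mul_2 in odd_p; exact odd_p. }
  rewrite Or in all; cbn [negb] in all.
  destruct (Z.eqb_spec (r mod 23) 0) as [r23|_].
  { exfalso; apply p23; rewrite Ep; replace (1472 * k) with (64 * k * 23) by ring.
    rewrite Z.mod_add by lia; exact r23. }
  apply existsb_exists in all as (s & Hs & Hgood).
  exists s; split; [rewrite Ep, good_trace_mod; exact Hgood|].
  cbn [In] in Hs.
  (* The threshold 73 comes from the largest trace in the list: 17^2 = 289 < 292 = 4 * 73. *)
  repeat (destruct Hs as [<- | Hs]; [lia|]); destruct Hs.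
Qed.

Lemma good_traceP (p s : Z) :
  good_trace p s = true ->
  Z.odd s = true /\ admissible p s = true /\ (4 * p - s * s) mod 8 = 3 /\
  (4 * p - s * s) mod 23 <> 0 /\ exists m, 0 < m /\ (4 * p - s * s - m * m) mod 23 = 0.
Proof.
  unfold good_trace; rewrite !andb_true_iff, Z.eqb_eq, existsb_exists.
  intros [[[odd_s adm] n8] (m & m_in & nm)]; apply Z.eqb_eq in nm.
  set (n := 4 * p - s * s) in *; clearbody n.
  split; [exact odd_s|split; [exact adm|split; [exact n8|split]]].
  - intros n23; clear n8; vm_compute in m_in.
    repeat (destruct m_in as [<- | m_in]; [Z.to_euclidean_division_equations; lia|]); destruct m_in.
  - exists m; split; [|exact nm].
    vm_compute in m_in; lia.
Qed.

(** Trial divisors 2, ..., 8 suffice below 73 < 9^2. *)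
Definition composite (p : Z) : bool :=
  existsb (fun d => (p mod d =? 0) && (d <? p)) (range 2 7).

Lemma small_integers_sum_bform :
  forallb (fun p => if composite p then true else
                    if existsb (Z.eqb p) [2; 5; 7; 23] then true else
    existsb (fun x => existsb (fun y => existsb (fun z => existsb (fun t =>
      bform x y + bform z t =? p) (range (-5) 11)) (range 0 4)) (range (-5) 11)) (range 0 4))
    (range 2 71) = true.
Proof. vm_compute; reflexivity. Qed.

Lemma small_primes_sum_bform (p : Z) :
  1 < p < 73 -> (forall d, 1 < d -> (d | p) -> d = p) ->
  p <> 2 -> p <> 5 -> p <> 7 -> p <> 23 -> exists x y z t, bform x y + bform z t = p.
Proof.
  intros Hp ndiv p2 p5 p7 p23.
  pose proof small_integers_sum_bform as all; rewrite forallb_forall in all.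
  specialize (all p (in_range 2 p 71 ltac:(lia))); cbv beta in all.
  destruct (composite p) eqn:Ec.
  { apply existsb_exists in Ec as (d & d_in & Hd).
    apply andb_true_iff in Hd as [dp lt]; apply Z.eqb_eq in dp; apply Z.ltb_lt in lt.
    apply in_map_iff in d_in as (i & <- & _).
    apply Z.mod_divide in dp; [|lia].
    assert (2 + Z.of_nat i = p) by (apply ndiv; [lia|exact dp]); lia. }
  destruct (existsb (Z.eqb p) [2; 5; 7; 23]) eqn:Ee.
  { apply existsb_exists in Ee as (e & e_in & He); apply Z.eqb_eq in He.
    cbn [In] in e_in; lia. }
  apply existsb_exists in all as (x & _ & all); apply existsb_exists in all as (y & _ & all).
  apply existsb_exists in all as (z & _ & all); apply existsb_exists in all as (t & _ & all).
  exists x, y, z, t; apply Z.eqb_eq, all.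
Qed.

From mathcomp Require Import all_boot all_order all_algebra zify ring lra realalg.
Set Implicit Arguments. Unset Strict Implicit. Unset Printing Implicit Defensive.
Import Order.TTheory GRing.Theory Num.Theory.
Close Scope Z_scope.

(** * The Jacobi symbol by Gauss's lemma *)

Section GaussSign.

Implicit Types n a b x : nat.

(** For odd n coprime to a, Gauss's count gives the Jacobi symbol even when n is composite.
    Multiplicativity and reciprocity follow from the count itself, without factoring n; squares
    enter only at prime moduli. *)
Definition gauss_sign n a : bool :=
  \big[addb/false]_(1 <= x < n./2.+1) (n < 2 * ((a * x) %% n)).

Lemma gauss_sign_mod n a : gauss_sign n (a %% n) = gauss_sign n a.
Proof. by apply: eq_bigr => x _; rewrite modnMml. Qed.

Lemma gauss_signE n a :
  gauss_sign n a = \big[addb/false]_(i < n./2) (n < 2 * ((a * i.+1) %% n)).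
Proof. by rewrite /gauss_sign big_add1 /= big_mkord. Qed.

Definition fold_mod n y := if n < 2 * (y %% n) then n - y %% n else y %% n.

Lemma modnM_neq0 n a x : coprime n a -> 0 < x < n -> 0 < (a * x) %% n.
Proof.
move=> co /andP[x0 xn]; rewrite lt0n; apply/negP => /eqP E.
have : n %| a * x by rewrite /dvdn E.
by rewrite Gauss_dvdr // => /dvdn_leq; lia.
Qed.

(* Up to sign, multiplication by a unit permutes the half-system 1, ..., (n - 1) / 2. *)
Lemma fold_mod_perm n b : odd n -> coprime n b ->
  exists2 rho : 'I_n./2 -> 'I_n./2, injective rho
    & forall i, (rho i).+1 = fold_mod n (b * i.+1).
Proof.
move=> on cob.
have n0 : 0 < n by case: n on {cob}.
have En : n = n./2.*2.+1 by rewrite -[LHS]odd_double_half on.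
have fold_bound (i : 'I_n./2) : 0 < fold_mod n (b * i.+1) <= n./2.
  have := modnM_neq0 cob (x := i.+1); have := ltn_pmod (b * i.+1) n0.
  by rewrite /fold_mod; have := ltn_ord i; case: ifP; lia.
have pred_bound (i : 'I_n./2) : (fold_mod n (b * i.+1)).-1 < n./2.
  by have := fold_bound i; lia.
pose rho i := Ordinal (pred_bound i).
have rhoS i : (rho i).+1 = fold_mod n (b * i.+1).
  by have := fold_bound i; rewrite /= ; lia.
exists rho => // i j /(congr1 (fun k : 'I__ => k.+1)); rewrite !rhoS => E.
have bnd (k : 'I_n./2) : k.+1 < n by have := ltn_ord k; lia.
have key : (n %| b * i.+1 + b * j.+1) || (b * i.+1 == b * j.+1 %[mod n]).
  have := ltn_pmod (b * i.+1) n0; have := ltn_pmod (b * j.+1) n0.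
  move: E; rewrite /fold_mod; case: ifP => h1; case: ifP => h2 E l1 l2.
  - by apply/orP; right; apply/eqP; lia.
  - apply/orP; left; rewrite /dvdn -modnDm.
    have -> : (b * i.+1) %% n + (b * j.+1) %% n = n by lia.
    by rewrite modnn.
  - apply/orP; left; rewrite /dvdn -modnDm.
    have -> : (b * i.+1) %% n + (b * j.+1) %% n = n by lia.
    by rewrite modnn.
  - by apply/orP; right; apply/eqP; lia.
apply: val_inj => /=; case/orP: key.
  rewrite -mulnDr Gauss_dvdr // => /dvdn_leq.
  by have := ltn_ord i; have := ltn_ord j; lia.
wlog: i j {E} / i <= j => [hw|].
  by case: (leqP i j) => [/hw//|/ltnW/hw h]; rewrite eq_sym => /h.
move=> ij; rewrite eq_sym eqn_mod_dvd ?leq_mul2l ?ltnS ?ij ?orbT //.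
by rewrite -mulnBr Gauss_dvdr // => /dvdn_leq; have := bnd j; lia.
Qed.

(** The sign of ab at x is the sign of b at x times that of a at the folded bx: replacing a residue
    r by n - r flips the sign, as n is odd. Folding permutes the half-system. *)
Lemma gauss_signM n a b : odd n -> coprime n a -> coprime n b ->
  gauss_sign n (a * b) = gauss_sign n a (+) gauss_sign n b.
Proof.
move=> on coa cob; rewrite !gauss_signE.
have n0 : 0 < n by case: n on {coa cob}.
have En : n = n./2.*2.+1 by rewrite -[LHS]odd_double_half on.
have [rho rho_inj rhoS] := fold_mod_perm on cob.
rewrite [X in _ = X (+) _](reindex_inj rho_inj) -big_split /=.
apply: eq_bigr => i _; rewrite rhoS /fold_mod.
have i1 : 0 < i.+1 < n by have := ltn_ord i; lia.
have r0 := modnM_neq0 cob i1; have rn := ltn_pmod (b * i.+1) n0.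
rewrite -mulnA -modnMmr; set r := _ %% n in r0 rn *.
have s0 := modnM_neq0 coa (x := r); have sn := ltn_pmod (a * r) n0.
case: ifP => h; last by rewrite addbF.
have -> : (a * (n - r)) %% n = n - (a * r) %% n.
  have -> : a * (n - r) = a * n - a * r by rewrite mulnBr.
  have h1 : (a * r) %% n + (n - (a * r) %% n) = n by lia.
  have : a * n - a * r = n - (a * r) %% n %[mod n].
    apply/eqP; rewrite -(eqn_modDl (a * r)) subnKC ?leq_mul2l ?(ltnW rn) ?orbT //.
    by rewrite modnMl -modnDml h1 modnn.
  by move=> ->; rewrite modn_small //; lia.
by rewrite addbT; lia.
Qed.

End GaussSign.

Lemma addb_const (r : seq nat) : \big[addb/false]_(i <- r) true = odd (size r).
Proof. by elim: r => [|x r IH]; rewrite ?big_nil // big_cons IH. Qed.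

Lemma gauss_sign_opp1 n : odd n -> 1 < n -> gauss_sign n n.-1 = odd n./2.
Proof.
move=> on n1; rewrite -[RHS](_ : odd (size (index_iota 1 n./2.+1)) = _); last first.
  by rewrite size_iota subn1.
rewrite -addb_const; apply: eq_big_nat => x /andP[x0 xn].
have En : n = n./2.*2.+1 by rewrite -[LHS]odd_double_half on.
have -> : n.-1 * x = (x - 1) * n + (n - x) by nia.
by rewrite modnMDl modn_small; lia.
Qed.

Lemma gauss_sign_2 n : n %% 8 = 3 -> gauss_sign n 2.
Proof.
move=> n8; pose k := n %/ 8; have En : n = 8 * k + 3 by rewrite /k; lia.
have Eh : n./2 = 4 * k + 1 by rewrite En; lia.
rewrite /gauss_sign Eh (@big_cat_nat _ _ _ (2 * k).+1) /=; [|lia|lia].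
rewrite big1_seq; last first.
  move=> x /andP[_]; rewrite mem_index_iota => /andP[x0 xk].
  by rewrite modn_small; lia.
rewrite addFb (eq_big_nat _ _ (F2 := fun=> true)); last first.
  by move=> x /andP[x0 xk]; rewrite modn_small; lia.
rewrite addb_const size_iota; have -> : (4 * k + 1).+1 - (2 * k).+1 = (2 * k).+1 by lia.
by rewrite /= oddM.
Qed.

(* Eisenstein's lattice points: the sign records the points (x, y) of the rectangle in a strip along the diagonal. *)
Lemma gauss_sign_strip n m : odd n -> odd m -> coprime n m ->
  gauss_sign n m =
  \big[addb/false]_(1 <= x < n./2.+1) \big[addb/false]_(1 <= y < m./2.+1)
    (2 * (m * x) < 2 * (n * y) < 2 * (m * x) + n).
Proof.
move=> on om co; apply: eq_big_nat => x /andP[x0 xn].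
have En : n = n./2.*2.+1 by rewrite -[LHS]odd_double_half on.
have Em : m = m./2.*2.+1 by rewrite -[LHS]odd_double_half om.
have n0 : 0 < n by lia.
have x1 : 0 < x < n by lia.
have r0 := modnM_neq0 co x1; have rn := ltn_pmod (m * x) n0.
have Eq := divn_eq (m * x) n.
set r := _ %% n in r0 rn Eq *; set q := _ %/ n in Eq.
case: (ltnP n (2 * r)) => h.
  (* The strip asks for a multiple of n above m x at distance less than n/2. Only y = q + 1 can
     qualify, precisely when 2r > n; it has to lie in the rectangle. *)
  have qm : q.+1 < m./2.+1.
    have : 2 * (m * x) <= m * (n - 1) by nia.
    rewrite Eq => hh; have : 2 * q.+1 * n < (m + 1) * n by nia.
    by rewrite ltn_pmul2r //; lia.
  rewrite (@big_cat_nat _ _ _ q.+1) /=; [|lia|lia].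
  rewrite big1_seq; last first.
    move=> y /andP[_]; rewrite mem_index_iota => /andP[y0 yq].
    by apply/negbTE; rewrite Eq; apply/negP => /andP[h1 _]; nia.
  rewrite addFb big_ltn // big1_seq; last first.
    move=> y /andP[_]; rewrite mem_index_iota => /andP[y0 yq].
    by apply/negbTE; rewrite Eq; apply/negP => /andP[_ h1]; nia.
  by rewrite addbF Eq; apply/esym/andP; split; nia.
rewrite big1_seq // => y _; apply/negbTE; rewrite Eq; apply/negP => /andP[h1 h2].
have : q < y by nia.
by move=> h3; nia.
Qed.

(** No lattice point of the rectangle is on the diagonal. The two signs count the points of the
    strips on its two sides, and the two regions left over, [P3] and [P4], are exchanged by the
    central symmetry of the rectangle, hence cancel modulo 2. *)
Lemma gauss_reciprocity n m : odd n -> odd m -> coprime n m ->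
  gauss_sign n m (+) gauss_sign m n = odd (n./2 * m./2).
Proof.
move=> on om co.
have En : n = n./2.*2.+1 by rewrite -[LHS]odd_double_half on.
have Em : m = m./2.*2.+1 by rewrite -[LHS]odd_double_half om.
rewrite (gauss_sign_strip on om co) (gauss_sign_strip om on); last by rewrite coprime_sym.
rewrite [X in _ (+) X]exchange_big -big_split /=.
under eq_bigr do rewrite -big_split /=.
pose P3 x y := 2 * (m * x) + n <= 2 * (n * y).
pose P4 x y := 2 * (n * y) + m <= 2 * (m * x).
have tot : odd (n./2 * m./2) = \big[addb/false]_(1 <= x < n./2.+1)
    \big[addb/false]_(1 <= y < m./2.+1) true.
  under eq_bigr do rewrite addb_const size_iota subn1 /=.
  rewrite oddM; have -> : odd n./2 = odd (size (index_iota 1 n./2.+1)) by rewrite size_iota subn1.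
  rewrite -addb_const big_distrl /=.
  by [].
have flip : \big[addb/false]_(1 <= x < n./2.+1) \big[addb/false]_(1 <= y < m./2.+1) P3 x y
    = \big[addb/false]_(1 <= x < n./2.+1) \big[addb/false]_(1 <= y < m./2.+1) P4 x y.
  rewrite big_nat_rev; apply: eq_big_nat => x /andP[x0 xn].
  rewrite big_nat_rev; apply: eq_big_nat => y /andP[y0 yn].
  rewrite /P3 /P4; set x' := 1 + _ - _; set y' := 1 + _ - _.
  have Ex : 2 * (m * x') + 2 * (m * x) = m * n + m.
    by rewrite -!mulnDr /x' -mulnSr [in RHS]En mulnCA; congr (_ * _); lia.
  have Ey : 2 * (n * y') + 2 * (n * y) = n * m + n.
    by rewrite -!mulnDr /y' -mulnSr [in RHS]Em mulnCA; congr (_ * _); lia.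
  by move: Ex Ey; rewrite [n * m]mulnC; lia.
rewrite tot.
have -> : \big[addb/false]_(1 <= x < n./2.+1) \big[addb/false]_(1 <= y < m./2.+1) true
   = \big[addb/false]_(1 <= x < n./2.+1) \big[addb/false]_(1 <= y < m./2.+1)
       ((2 * (m * x) < 2 * (n * y) < 2 * (m * x) + n)
        (+) (2 * (n * y) < 2 * (m * x) < 2 * (n * y) + m))
     (+) (\big[addb/false]_(1 <= x < n./2.+1) \big[addb/false]_(1 <= y < m./2.+1) P3 x y
          (+) \big[addb/false]_(1 <= x < n./2.+1) \big[addb/false]_(1 <= y < m./2.+1) P4 x y).
  rewrite -!big_split /=; apply: eq_big_nat => x /andP[x0 xn].
  rewrite -!big_split /=; apply: eq_big_nat => y /andP[y0 yn].
  have neq : m * x != n * y.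
    apply/negP => /eqP E; have : n %| m * x by rewrite E dvdn_mulr.
    by rewrite Gauss_dvdr // => /dvdn_leq; lia.
  rewrite /P3 /P4; move: (m * x) (n * y) neq => s t; lia.
by rewrite flip addbb addbF.
Qed.

Lemma Fp_nat_eq0 r k : prime r -> ((k%:R : 'F_r) == 0)%R = (r %| k).
Proof. by move=> pr; rewrite (dvdn_pcharf (pchar_Fp pr)). Qed.

Lemma signr_big_addb (R : comNzRingType) (I : Type) (r : seq I) (s : I -> bool) :
  ((-1) ^+ (\big[addb/false]_(i <- r) s i) = \prod_(i <- r) (-1) ^+ s i :> R)%R.
Proof. by elim/big_rec2: _ => // i b x _ <-; rewrite signr_addb. Qed.

Lemma gauss_lemma r a : prime r -> odd r -> coprime r a ->
  ((a%:R : 'F_r) ^+ r./2 = (-1) ^+ gauss_sign r a)%R.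
Proof.
move=> pr od co; have r0 := prime_gt0 pr.
have Er : r = r./2.*2.+1 by rewrite -[LHS]odd_double_half od.
have [rho rho_inj rhoS] := fold_mod_perm od co.
pose F := (\prod_(i < r./2) (i.+1%:R : 'F_r))%R.
have F0 : (F != 0)%R.
  apply/prodf_neq0 => i _; rewrite Fp_nat_eq0 //; apply/negP => /dvdn_leq.
  by have := ltn_ord i; lia.
apply: (mulIf F0); transitivity (\prod_(i < r./2) ((a * i.+1)%:R : 'F_r))%R.
  rewrite /F -[X in (_ ^+ X)%R]card_ord -prodr_const -big_split /=.
  by apply: eq_bigr => i _; rewrite natrM.
rewrite [X in (_ * X)%R](reindex_inj rho_inj) gauss_signE.
rewrite signr_big_addb -big_split /=.
apply: eq_bigr => i _; rewrite rhoS /fold_mod; set y := a * _.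
have yr := ltn_pmod y r0.
have Ey : (y%:R = (y %% r)%:R :> 'F_r)%R.
  by rewrite [in LHS](divn_eq y r) natrD natrM -[r in (_ * r%:R)%R]/r pchar_Fp_0 // mulr0 add0r.
case: ifP => _; last by rewrite mul1r.
by rewrite expr1 mulN1r natrB ?(ltnW yr) // pchar_Fp_0 // sub0r opprK.
Qed.

(** Otherwise a, together with the (r - 1)/2 nonzero squares, would give X^((r-1)/2) - 1 too many
    roots. *)
Lemma gauss_sign_prime r a : prime r -> odd r -> coprime r a -> gauss_sign r a = false ->
  exists w, w ^ 2 = a %[mod r].
Proof.
move=> pr od co g0; have r0 := prime_gt0 pr.
have Er : r = r./2.*2.+1 by rewrite -[LHS]odd_double_half od.
pose sq := [seq ((i.+1%:R : 'F_r) ^+ 2)%R | i : 'I_r./2].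
have [/mapP[i _ Ei]|nsq] := boolP ((a%:R : 'F_r)%R \in sq).
  exists i.+1; move: Ei; rewrite -natrX => /(congr1 val).
  by rewrite /= !val_Fp_nat.
have h0 : 0 < r./2 by have := prime_gt1 pr; lia.
have bnd (i : 'I_r./2) : ~~ (r %| i.+1).
  by apply/negP => /dvdn_leq; have := ltn_ord i; lia.
have rootP x : coprime r x -> gauss_sign r x = false ->
   root ('X^(r./2) - 1 : {poly 'F_r})%R x%:R%R.
  by move=> cox gx; rewrite rootE !hornerE gauss_lemma // gx expr0 subrr.
suff : size (a%:R :: sq)%R < size ('X^(r./2) - 1 : {poly 'F_r})%R.
  by rewrite size_XnsubC // /= size_map size_enum_ord ltnn.
apply: max_poly_roots.
- by rewrite -size_poly_eq0 size_XnsubC.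
- rewrite /= rootP //=; apply/allP => _ /mapP[i _ ->].
  have coi : coprime r i.+1 by rewrite prime_coprime ?bnd.
  by rewrite expr2 -natrM rootP ?coprimeMr ?coi // gauss_signM // addbb.
- rewrite /= nsq map_inj_uniq ?enum_uniq // => i j /eqP.
  rewrite eqf_sqr -addr_eq0 -natrD Fp_nat_eq0 // => /orP[] h.
    apply: val_inj; move: h.
    wlog ij : i j / i <= j => [hw|].
      by case: (leqP i j) => [/hw//|/ltnW/hw h]; rewrite eq_sym => /h.
    rewrite -subr_eq0 -opprB oppr_eq0 -natrB ?ltnS // Fp_nat_eq0 // subSS => h.
    case: (posnP (j - i)) => [/eqP ji|ji].
      by apply/eqP; rewrite eqn_leq ij -subn_eq0.
    by have := dvdn_leq ji h; have := ltn_ord j; lia.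
  by have := dvdn_leq _ h; have := ltn_ord i; have := ltn_ord j; lia.
Qed.

Local Open Scope ring_scope.

(** * Averages of divisor sums *)

Record real_character (n : nat) (chi : nat -> int) : Prop := RealCharacter {
  chi_mod : forall a, chi (a %% n)%N = chi a;
  chiM : forall a b, chi (a * b)%N = chi a * chi b;
  chi_sqr : forall a, chi a ^+ 2 = (coprime n a)%:R }.

(** The coefficients of zeta(s) L(s, chi). *)
Definition divisor_sum (chi : nat -> int) (a : nat) : int := \sum_(d <- divisors a) chi d.

Section DivisorSum.

Variables (n : nat) (chi : nat -> int).
Hypothesis chiP : real_character n chi.

Let chi_M := chiM chiP.

Lemma chi1 : chi 1%N = 1.
Proof. by have := chi_sqr chiP 1; rewrite coprimen1 expr2 -chi_M. Qed.

Lemma chi_neq0 a : coprime n a -> chi a = 1 \/ chi a = -1.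
Proof.
move=> co; have /eqP := chi_sqr chiP a.
by rewrite co sqrf_eq1 => /orP[] /eqP; [left|right].
Qed.

Lemma chi_eq0 a : (chi a == 0) = ~~ coprime n a.
Proof. by rewrite -sqrf_eq0 (chi_sqr chiP); case: (coprime n a). Qed.

Lemma divisor_sum_primeM r k b : prime r -> (0 < b)%N -> ~~ (r %| b)%N ->
  divisor_sum chi (r ^ k.+1 * b) = chi r * divisor_sum chi (r ^ k * b) + divisor_sum chi b.
Proof.
move=> pr b0 rb; have r0 := prime_gt0 pr.
have cor m : coprime (r ^ m) b by rewrite coprimeXl // prime_coprime.
have a0 m : (0 < r ^ m * b)%N by rewrite muln_gt0 expn_gt0 r0.
rewrite /divisor_sum (bigID (fun d => r %| d)%N) /=.
rewrite -[X in X + _]big_filter -[X in _ + X]big_filter mulr_sumr; congr (_ + _).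
  transitivity (\sum_(d <- [seq (r * d)%N | d <- divisors (r ^ k * b)]) chi d); last first.
    by rewrite big_map; apply: eq_bigr => d _; rewrite chi_M.
  apply: perm_big; apply: uniq_perm.
  - by rewrite filter_uniq ?divisors_uniq.
  - by rewrite map_inj_uniq ?divisors_uniq // => x y /eqP; rewrite eqn_pmul2l // => /eqP.
  move=> d; rewrite mem_filter -dvdn_divisors //; apply/andP/mapP => [[rd] | [e]].
    case/dvdnP: rd => e ->; rewrite expnS -mulnA mulnC dvdn_pmul2l // => h.
    by exists e; rewrite -?dvdn_divisors // mulnC.
  by rewrite -dvdn_divisors // => h ->; rewrite dvdn_mulr // expnS -mulnA dvdn_pmul2l.
apply: perm_big; apply: uniq_perm; rewrite ?filter_uniq ?divisors_uniq // => d.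
rewrite mem_filter -!dvdn_divisors //; apply/andP/idP => [[rd] | db].
  by rewrite Gauss_dvdr // coprime_sym coprimeXl // prime_coprime.
by split; [apply: contra rb => /dvdn_trans; apply | rewrite dvdn_mull].
Qed.

(** The sum 1 + x + ... + x^k in Horner form. *)
Fixpoint local_factor (x : int) (k : nat) : int :=
  if k is k'.+1 then x * local_factor x k' + 1 else 1.

Lemma divisor_sum_local r k b : prime r -> (0 < b)%N -> ~~ (r %| b)%N ->
  divisor_sum chi (r ^ k * b) = local_factor (chi r) k * divisor_sum chi b.
Proof.
move=> pr b0 rb; elim: k => [|k IH]; first by rewrite mul1n mul1r.
by rewrite divisor_sum_primeM // IH /= mulrDl mul1r mulrA.
Qed.

Lemma local_factor1 k : local_factor 1 k = k.+1%:R.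
Proof. by elim: k => //= k ->; rewrite mul1r natr1. Qed.

Lemma local_factorN1 k : local_factor (-1) k = (~~ odd k)%:R.
Proof. by elim: k => //= k ->; rewrite negbK; case: (odd k); rewrite /= ?mulr0 ?mulr1 ?add0r ?addNr. Qed.

Lemma local_factor0 k : local_factor 0 k = 1.
Proof. by case: k => //= k; rewrite mul0r add0r. Qed.

Lemma chi_cases a : [\/ chi a = 1, chi a = -1 | chi a = 0].
Proof.
have [co|] := boolP (coprime n a).
  by case: (chi_neq0 co) => ->; [constructor 1 | constructor 2].
by rewrite -chi_eq0 => /eqP ->; constructor 3.
Qed.

Lemma local_factor_ge0 a k : 0 <= local_factor (chi a) k.
Proof.
by case: (chi_cases a) => ->; rewrite ?local_factor1 ?local_factorN1 ?local_factor0 ?ler0n.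
Qed.

Lemma local_factor_even a k : ~~ odd k -> 1 <= local_factor (chi a) k.
Proof.
move=> ek; case: (chi_cases a) => ->;
  by rewrite ?local_factor1 ?local_factorN1 ?local_factor0 ?ek ?ler1n.
Qed.

Lemma prime_split a : (1 < a)%N ->
  exists r k b, [/\ prime r, (0 < k)%N, (0 < b < a)%N, ~~ (r %| b)%N & a = (r ^ k * b)%N].
Proof.
move=> a1; have a0 : (0 < a)%N by lia.
have pr := pdiv_prime a1; have r1 := prime_gt1 pr.
have [k k0 [b cob Ea]] : exists2 k, (0 < k)%N & exists2 b, coprime (pdiv a) b & a = (pdiv a ^ k * b)%N.
  have [b cob Eb] := pfactor_coprime pr a0.
  exists (logn (pdiv a) a); last by exists b; rewrite // mulnC.
  by rewrite logn_gt0 mem_primes pr a0 pdiv_dvd.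
exists (pdiv a), k, b; split=> //; last by rewrite -prime_coprime.
have b0 : (0 < b)%N by case: b Ea {cob} => //; rewrite muln0; lia.
rewrite b0 /= [X in (_ < X)%N]Ea -[X in (X < _)%N]mul1n ltn_pmul2r //.
by rewrite -(expn0 (pdiv a)) ltn_exp2l.
Qed.

Lemma divisor_sum1 : divisor_sum chi 1 = 1.
Proof. by rewrite /divisor_sum big_seq1 chi1. Qed.

Lemma divisor_sum_ge0 a : (0 < a)%N -> 0 <= divisor_sum chi a.
Proof.
elim/ltn_ind: a => a IH a0; have [a1|a1] := leqP a 1.
  have -> : a = 1%N by lia.
  by rewrite divisor_sum1.
have [r [k [b [pr k0 /andP[b0 ba] rb ->]]]] := prime_split a1.
by rewrite divisor_sum_local // mulr_ge0 ?local_factor_ge0 ?IH.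
Qed.

Lemma divisor_sum_sqr_ge1 a : (0 < a)%N -> 1 <= divisor_sum chi (a ^ 2).
Proof.
elim/ltn_ind: a => a IH a0; have [a1|a1] := leqP a 1.
  have -> : a = 1%N by lia.
  by rewrite divisor_sum1.
have [r [k [b [pr k0 /andP[b0 ba] rb ->]]]] := prime_split a1.
have b20 : (0 < b ^ 2)%N by rewrite expn_gt0 b0.
rewrite expnMn -expnM divisor_sum_local // ?Euclid_dvdX // ?negb_and ?rb //.
rewrite -[leLHS]mulr1; apply: ler_pM => //; last exact: IH.
by apply: local_factor_even; rewrite oddM andbF.
Qed.

(** Lowering an exponent by 2 keeps a positive local factor positive: the factor is k + 1, the
    indicator of even k, or 1. Once b is squarefree, each of its primes contributes 1 + chi r, which
    is positive only for chi r = 1, since chi r = 0 is excluded by coprimality. *)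
Lemma minimal_divisor_sum (S : pred nat) a :
  (forall r b, prime r -> S (r ^ 2 * b)%N -> S b) -> (forall b, S b -> coprime n b) ->
  (0 < a)%N -> S a -> 0 < divisor_sum chi a ->
  exists b, [/\ (0 < b)%N, S b & forall r, prime r -> (r %| b)%N -> chi r = 1 /\ ~~ (r ^ 2 %| b)%N].
Proof.
move=> Sdiv Sco; elim/ltn_ind: a => a IH a0 Sa Ra.
have [hsq|nsq] := boolP [exists r : 'I_a.+1, prime r && (r ^ 2 %| a)%N]; last first.
  exists a; split=> // r pr ra.
  have nra : ~~ (r ^ 2 %| a)%N.
    move/existsPn: nsq => /(_ (Ordinal (_ : r < a.+1)%N)).
    by move=> /(_ (dvdn_leq a0 ra)); rewrite /= pr.
  split=> //; have [b cob Eb] := pfactor_coprime pr a0.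
  have lr : logn r a = 1%N.
    apply/eqP; rewrite eqn_leq logn_gt0 mem_primes pr a0 ra /= andbT.
    by rewrite leqNgt; apply/negP => h; move/negP: nra; apply; rewrite pfactor_dvdn.
  have b0 : (0 < b)%N by case: b Eb {cob} => //; rewrite mul0n; lia.
  move: Ra; rewrite Eb lr mulnC divisor_sum_local // -?prime_coprime // /= mulr1.
  have cor : coprime n r by apply: coprime_dvdr ra _; apply: Sco.
  by case: (chi_neq0 cor) => -> //; rewrite addNr mul0r.
case/existsP: hsq => r /andP[pr r2a].
have r1 := prime_gt1 pr.
case/dvdnP: (r2a) => b Eb; rewrite mulnC in Eb.
have b0 : (0 < b)%N by case: b Eb => //; rewrite muln0; lia.
have ba : (b < a)%N by rewrite Eb -[X in (X < _)%N]mul1n ltn_pmul2r //; nia.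
apply: (IH b) => //; first by apply: (Sdiv r); rewrite -?Eb.
have [c coc Ec] := pfactor_coprime pr b0.
have c0 : (0 < c)%N by case: c Ec {coc} => //; rewrite mul0n; lia.
move: Ra; rewrite Eb Ec [(c * _)%N]mulnC mulnA -expnD !divisor_sum_local // -?prime_coprime //.
have := divisor_sum_ge0 c0; rewrite le_eqVlt => /orP[/eqP <-|Rc]; first by rewrite !mulr0 ltxx.
rewrite !pmulr_lgt0 //; case: (chi_cases r) => ->.
- by rewrite !local_factor1 !ltr0n.
- by rewrite !local_factorN1 /= negbK.
- by rewrite !local_factor0.
Qed.

End DivisorSum.

(** * Rearranging sums over the region ef <= X *)

Section HyperbolaSums.

Variable V : zmodType.
Implicit Type F : nat -> nat -> V.

Lemma hyperbola_cond F X e : (0 < e)%N ->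
  \sum_(1 <= f < (X %/ e).+1) F e f = \sum_(1 <= f < X.+1 | (e * f <= X)%N) F e f.
Proof.
move=> e0; rewrite (big_nat_widen _ _ X.+1) ?ltnS ?leq_div //.
by apply: eq_bigl => f; rewrite /= ltnS leq_divRL // mulnC.
Qed.

Lemma hyperbola_exchange F X m : (0 < m)%N ->
  \sum_(m <= e < X.+1) \sum_(1 <= f < (X %/ e).+1) F e f =
  \sum_(1 <= f < X.+1) \sum_(m <= e < (X %/ f).+1) F e f.
Proof.
move=> m0.
transitivity (\sum_(m <= e < X.+1) \sum_(1 <= f < X.+1 | (e * f <= X)%N) F e f).
  by apply: eq_big_nat => e /andP[me _]; rewrite hyperbola_cond //; lia.
under eq_bigr do rewrite big_mkcond.
rewrite exchange_big /=; apply: eq_big_nat => f /andP[f0 fX]; rewrite -big_mkcond /=.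
rewrite [RHS](big_nat_widen _ _ X.+1) ?ltnS ?leq_div //.
by apply: eq_bigl => e; rewrite /= ltnS leq_divRL.
Qed.

Lemma divisors_sum_nat X a (t : nat -> V) : (0 < a <= X)%N ->
  \sum_(e <- divisors a) t e = \sum_(1 <= e < X.+1 | (e %| a)%N) t e.
Proof.
case/andP=> a0 aX; rewrite -[RHS]big_filter; apply: perm_big; apply: uniq_perm.
- exact: divisors_uniq.
- by rewrite filter_uniq ?iota_uniq.
move=> e; rewrite mem_filter mem_index_iota -dvdn_divisors //; case: (boolP (e %| a)%N) => //= ea.
have := dvdn_leq a0 ea; have : (0 < e)%N by case: e ea => //; rewrite dvd0n; lia.
lia.
Qed.

Lemma multiples_sum_nat X e (t : nat -> V) : (0 < e)%N ->
  \sum_(1 <= a < X.+1 | (e %| a)%N) t a = \sum_(1 <= f < (X %/ e).+1) t (e * f)%N.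
Proof.
move=> e0; rewrite -[LHS]big_filter.
transitivity (\sum_(a <- [seq (e * f)%N | f <- index_iota 1 (X %/ e).+1]) t a); last first.
  by rewrite big_map.
apply: perm_big; apply: uniq_perm.
- by rewrite filter_uniq ?iota_uniq.
- by rewrite map_inj_uniq ?iota_uniq // => x y /eqP; rewrite eqn_pmul2l // => /eqP.
move=> a; rewrite mem_filter mem_index_iota; apply/andP/mapP => [[/dvdnP[f ->]]|[f]].
  rewrite muln_gt0 => h; exists f; last by rewrite mulnC.
  by rewrite mem_index_iota ltnS leq_divRL //; lia.
rewrite mem_index_iota ltnS leq_divRL // => h ->; rewrite dvdn_mulr //.
by rewrite muln_gt0 e0 ltnS [(e * f)%N]mulnC; lia.
Qed.

Lemma hyperbola_divisors F X :
  \sum_(1 <= e < X.+1) \sum_(1 <= f < (X %/ e).+1) F e f =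
  \sum_(1 <= a < X.+1) \sum_(e <- divisors a) F e (a %/ e)%N.
Proof.
transitivity (\sum_(1 <= a < X.+1) \sum_(1 <= e < X.+1 | (e %| a)%N) F e (a %/ e)%N); last first.
  by apply: eq_big_nat => a h; rewrite (@divisors_sum_nat X) //; lia.
under [RHS]eq_bigr do rewrite big_mkcond.
rewrite [RHS]exchange_big /=; apply: eq_big_nat => e /andP[e0 eX]; rewrite -big_mkcond /=.
rewrite multiples_sum_nat //; apply: eq_big_nat => f _.
by rewrite mulKn.
Qed.

End HyperbolaSums.

(** * Periodic sums, partial summation and the harmonic series *)

Section Summation.

Variable R : realFieldType.
Implicit Types h w : nat -> R.

Lemma period_sum n h j : (forall i, h (i + n)%N = h i) ->
  \sum_(j <= i < j + n) h i = \sum_(0 <= i < n) h i.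
Proof.
move=> per; elim: j => [|j IH] //; rewrite -IH.
case: n per {IH} => [|n] per; first by rewrite !addn0 !big_geq.
rewrite addSn big_nat_recr /=; last by lia.
rewrite per [RHS]big_ltn; last by lia.
exact: addrC.
Qed.

Lemma interval_sum_bound n h (H : R) : (0 < n)%N -> 0 <= H ->
  (forall i, h (i + n)%N = h i) -> \sum_(0 <= i < n) h i = 0 -> (forall i, `|h i| <= H) ->
  forall j k, `|\sum_(j <= i < k) h i| <= n%:R * H.
Proof.
move=> n0 H0 per sum0 hH j k.
have nH : 0 <= n%:R * H by rewrite mulr_ge0.
have [kj|] := leqP k j; first by rewrite big_geq // normr0.
move/ltnW/subnKC <-; move: (k - j)%N => m; elim/ltn_ind: m j => m IH j.
have [mn|nm] := leqP m n.
  apply: le_trans (ler_norm_sum _ _ _) _.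
  apply: (@le_trans _ _ (\sum_(j <= i < j + m) H)); first by apply: ler_sum => i _.
  rewrite big_const_nat iter_addr_0 addKn -[leLHS]mulr_natl.
  by rewrite ler_wpM2r ?ler_nat.
rewrite (@big_cat_nat _ _ _ (j + n)%N) /=; [|lia|lia].
rewrite period_sum // sum0 add0r.
have -> : (j + m)%N = (j + n + (m - n))%N by lia.
by apply: IH; lia.
Qed.

Lemma abel_bound h w (B : R) j : (forall k, `|\sum_(j <= i < k) h i| <= B) ->
  (forall i, 0 <= w i) -> (forall i, (j <= i)%N -> w i.+1 <= w i) ->
  forall k, `|\sum_(j <= i < k) h i * w i| <= B * w j.
Proof.
move=> hB w0 wdec k.
have B0 : 0 <= B by apply: le_trans (normr_ge0 _) (hB j).
have [kj|] := leqP k j; first by rewrite big_geq // normr0 mulr_ge0.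
move/ltnW/subnKC <-; move: (k - j)%N => {k} m.
pose Hs k := \sum_(j <= i < k) h i.
have -> : \sum_(j <= i < j + m) h i * w i =
  \sum_(j <= i < j + m) Hs i.+1 * (w i - w i.+1) + Hs (j + m)%N * w (j + m)%N.
  elim: m => [|m IH]; first by rewrite addn0 !big_geq // /Hs big_geq // mul0r addr0.
  rewrite addnS !big_nat_recr /=; [|lia|lia].
  by rewrite IH [Hs (j + m).+1]big_nat_recr /=; [rewrite -/(Hs (j + m)%N); ring|lia].
have -> : B * w j = \sum_(j <= i < j + m) B * (w i - w i.+1) + B * w (j + m)%N.
  elim: m => [|m IH]; first by rewrite addn0 big_geq // add0r.
  by rewrite addnS big_nat_recr /=; [rewrite IH; ring|lia].
apply: le_trans (ler_normD _ _) _; apply: lerD; last first.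
  by rewrite normrM (ger0_norm (w0 _)); apply: ler_wpM2r => //; apply: hB.
apply: le_trans (ler_norm_sum _ _ _) _.
apply: ler_sum_nat => i /andP[ji _].
rewrite normrM [X in _ * X]ger0_norm ?subr_ge0 ?wdec //.
by apply: ler_wpM2r; [rewrite subr_ge0 wdec | apply: hB].
Qed.

Lemma harmonic_ge k : k%:R / 2 <= \sum_(0 <= j < 2 ^ k) j.+1%:R^-1 :> R.
Proof.
elim: k => [|k IH]; first by rewrite mul0r sumr_ge0 // => i _; rewrite invr_ge0.
rewrite (@big_cat_nat _ _ _ (2 ^ k)%N) //=; last by rewrite leq_exp2l.
rewrite -natr1 mulrDl mul1r; apply: lerD => //.
apply: (@le_trans _ _ (\sum_(2 ^ k <= j < 2 ^ k.+1) (2 ^ k.+1)%:R^-1)).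
  have p0 : (2 ^ k)%:R != 0 :> R by rewrite pnatr_eq0 expn_eq0.
  rewrite sumr_const_nat; have -> : (2 ^ k.+1 - 2 ^ k = 2 ^ k)%N.
    by rewrite expnS mul2n -addnn addnK.
  by rewrite -[leRHS]mulr_natl expnS natrM invfM mulrCA mulfV // mulr1.
apply: ler_sum_nat => j /andP[_ jk].
by rewrite lef_pV2 ?posrE ?ltr0n ?ler_nat // expn_gt0.
Qed.

End Summation.

(** * An element of S with positive divisor sum *)

Section Averaging.

Variables (R : rcfType) (n : nat) (chi : nat -> int) (S : pred nat) (a0 b0 : nat).
Hypotheses (n_gt0 : (0 < n)%N) (chiP : real_character n chi).
Hypothesis S_mod : forall a, S (a %% n)%N = S a.
Hypothesis S_chi : forall a, S a -> chi a = 1.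
Hypotheses (Sa0 : S a0) (chi_b0 : chi b0 = -1).

Let w (e : nat) : R := (Num.sqrt e%:R)^-1.
Let x (e : nat) : R := (chi e)%:~R.
Let psi (e : nat) : R := (coprime n e)%:R.
Let g (e : nat) : R := (S e)%:R.
Let phi : R := \sum_(0 <= e < n) psi e.
Let sigma : R := \sum_(0 <= e < n) g e.

Let xM e f : x (e * f) = x e * x f. Proof. by rewrite /x (chiM chiP) intrM. Qed.
Let psiM e f : psi (e * f) = psi e * psi f.
Proof. by rewrite /psi coprimeMr -natrM mulnb. Qed.

Let x_mod e : x (e %% n) = x e. Proof. by rewrite /x (chi_mod chiP). Qed.
Let psi_mod e : psi (e %% n) = psi e. Proof. by rewrite /psi coprime_modr. Qed.
Let g_mod e : g (e %% n) = g e. Proof. by rewrite /g S_mod. Qed.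

Let psi_norm e : `|psi e| <= 1. Proof. by rewrite /psi; case: coprime; rewrite ?normr1 ?normr0. Qed.
Let g_norm e : `|g e| <= 1. Proof. by rewrite /g; case: (S e); rewrite ?normr1 ?normr0. Qed.
Let x_norm e : `|x e| <= 1.
Proof. by rewrite /x; case: (chi_cases chiP e) => ->; rewrite ?normrN ?normr1 ?normr0. Qed.

Let unit_sum (h : nat -> R) e : (forall i, h (i %% n)%N = h i) -> coprime n e ->
  \sum_(0 <= f < n) h (e * f)%N = \sum_(0 <= f < n) h f.
Proof.
move=> hmod co; rewrite !big_mkord.
have lt i : ((e * i) %% n < n)%N by rewrite ltn_pmod.
pose s (i : 'I_n) := Ordinal (lt i).
have s_inj : injective s.
  move=> i j /(congr1 val) /= /eqP E; apply: val_inj; move: E => /=.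
  wlog ij : i j / (i <= j)%N => [hw|].
    by case: (leqP i j) => [/hw//|/ltnW/hw hji]; rewrite eq_sym => /hji.
  rewrite eq_sym eqn_mod_dvd ?leq_mul2l ?ij ?orbT // -mulnBr Gauss_dvdr //.
  case: (posnP (j - i)) => [/eqP ji _|ji /(dvdn_leq ji)].
    by apply/eqP; rewrite eqn_leq ij -subn_eq0.
  by have := ltn_ord j; lia.
by rewrite [RHS](reindex_inj s_inj); apply: eq_bigr => i _; rewrite /= hmod.
Qed.

Let x_sum : \sum_(0 <= e < n) x e = 0.
Proof.
have co : coprime n b0 by rewrite -[coprime _ _]negbK -(chi_eq0 chiP) chi_b0.
have /eqP := unit_sum x_mod co; under eq_bigr do rewrite xM.
rewrite -mulr_sumr /x chi_b0 mulN1r eq_sym -subr_eq0 opprK -mulr2n -mulr_natl mulf_eq0.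
by rewrite pnatr_eq0 => /eqP.
Qed.

(* [x e * g (e * f)] minus its mean values, scaled by [phi]. *)
Let G e f : R := phi * (x e * g (e * f)) - sigma * (x e * psi f + psi e * x f).

(** If ef lies in S then chi(e) chi(f) = 1, so chi(e) = chi(f). The symmetry makes [G] mean-zero in
    both variables and lets one tail estimate serve for both. *)
Let G_sym e f : G e f = G f e.
Proof.
rewrite /G [(f * e)%N]mulnC; congr (_ * _ - _ * _); last by rewrite addrC mulrC [x e * _]mulrC.
rewrite /g; case: (boolP (S _)) => [/S_chi|]; last by rewrite !mulr0.
rewrite (chiM chiP) /x !mulr1; case: (chi_cases chiP e) => ->; last by rewrite mul0r.
  by rewrite mul1r => ->.
by rewrite mulN1r => /(congr1 -%R); rewrite opprK => ->.
Qed.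

Let G_mod e f : G e (f + n)%N = G e f.
Proof.
rewrite /G -[x (f + n)%N]x_mod -[psi (f + n)%N]psi_mod -[g (e * (f + n))]g_mod.
by rewrite mulnDr addnC modnMDl modnDr x_mod psi_mod g_mod.
Qed.

Let G_sum e : \sum_(0 <= f < n) G e f = 0.
Proof.
rewrite /G sumrB -!mulr_sumr big_split /= -!mulr_sumr x_sum mulr0 addr0 -/phi.
have [co|nco] := boolP (coprime n e).
  by rewrite (unit_sum g_mod co) -/sigma; ring.
have -> : x e = 0 by apply/eqP; rewrite /x intr_eq0 (chi_eq0 chiP).
by rewrite !mul0r !mulr0 subrr.
Qed.

Let sum01_bound (h : nat -> R) : (forall e, `|h e| <= 1) -> `|\sum_(0 <= e < n) h e| <= n%:R.
Proof.
move=> h1; apply: le_trans (ler_norm_sum _ _ _) _.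
apply: (@le_trans _ _ (\sum_(0 <= e < n) 1)); first by apply: ler_sum => e _; exact: h1.
by rewrite sumr_const_nat subn0.
Qed.

Let G_norm e f : `|G e f| <= 3 * n%:R.
Proof.
have le1 (u v : R) : `|u| <= 1 -> `|v| <= 1 -> `|u * v| <= 1.
  by move=> hu hv; rewrite normrM mulr_ile1.
apply: le_trans (ler_normB _ _) _.
have h1 : `|phi * (x e * g (e * f))| <= n%:R.
  by rewrite normrM -[leRHS]mulr1 ler_pM ?sum01_bound ?le1.
have h2 : `|sigma * (x e * psi f + psi e * x f)| <= n%:R * 2.
  rewrite normrM ler_pM ?sum01_bound //.
  by apply: le_trans (ler_normD _ _) _; have := le1 _ _ (x_norm e) (psi_norm f);
     have := le1 _ _ (psi_norm e) (x_norm f); lra.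
lra.
Qed.

Let w_ge0 e : 0 <= w e. Proof. by rewrite invr_ge0 sqrtr_ge0. Qed.
Let w1 : w 1 = 1. Proof. by rewrite /w sqrtr1 invr1. Qed.
Let wM e f : w e * w f = w (e * f)%N.
Proof. by rewrite /w natrM sqrtrM // invfM. Qed.
Let w_decr e : (0 < e)%N -> w e.+1 <= w e.
Proof.
move=> e_gt0; rewrite lef_pV2 ?posrE ?sqrtr_gt0 ?ltr0n //.
by rewrite ler_wsqrtr // ler_nat.
Qed.

Let w_sum N : \sum_(1 <= e < N.+1) w e <= 2 * Num.sqrt N%:R.
Proof.
elim: N => [|N IH]; first by rewrite big_geq // sqrtr0 mulr0.
rewrite big_nat_recr //=; set s := Num.sqrt N%:R in IH *; set t := Num.sqrt N.+1%:R.
have t0 : 0 < t by rewrite sqrtr_gt0 ltr0n.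
have s0 : 0 <= s by exact: sqrtr_ge0.
have Et : t ^+ 2 = s ^+ 2 + 1 by rewrite !sqr_sqrtr // -natr1.
have wt : w N.+1 * t = 1 by rewrite mulVf // gt_eqF.
suff : w N.+1 <= 2 * (t - s) by lra.
rewrite -(ler_pM2r t0) wt.
have := sqr_ge0 (t - s); nra.
Qed.

Let B : R := n%:R * (3 * n%:R).

Let G_interval e j k : `|\sum_(j <= f < k) G e f| <= B.
Proof.
by apply: interval_sum_bound => //; rewrite mulr_ge0.
Qed.

Let G_tail e j k : (0 < j)%N -> `|\sum_(j <= f < k) G e f * w f| <= B * w j.
Proof.
by move=> j0; apply: abel_bound => // i ji; apply: w_decr; lia.
Qed.

(** Dirichlet's hyperbola method. The region is the square e, f <= N and two mirror-image tails. In
    the square, two partial summations give n B. In a tail, summing over f > N gives B w(N + 1), and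
    the remaining sum of [w] up to N is at most 2 N^(1/2), which gives 2 B. The bound is independent
    of N. *)
Let G_hyperbola N : (0 < N)%N ->
  `|\sum_(1 <= e < (N ^ 2).+1) \sum_(1 <= f < (N ^ 2 %/ e).+1) G e f * (w e * w f)|
   <= (n%:R + 4) * B.
Proof.
move=> N0; set X := (N ^ 2)%N.
have NX : (N <= X)%N by rewrite /X; nia.
pose F e f := G e f * (w e * w f).
have F_sym e f : F e f = F f e by rewrite /F G_sym [w e * _]mulrC.
have B0 : 0 <= B by rewrite !mulr_ge0.
pose T := \sum_(1 <= e < N.+1) \sum_(N.+1 <= f < (X %/ e).+1) F e f.
pose Q := \sum_(1 <= e < N.+1) \sum_(1 <= f < N.+1) F e f.
have divN e : (e < N.+1)%N -> (0 < e)%N -> (N <= X %/ e)%N.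
  by move=> eN e0; rewrite leq_divRL // /X; nia.
rewrite (@big_cat_nat _ _ _ N.+1) //=.
have -> : \sum_(1 <= e < N.+1) \sum_(1 <= f < (X %/ e).+1) F e f = Q + T.
  rewrite -big_split /=; apply: eq_big_nat => e /andP[e0 eN].
  by rewrite (@big_cat_nat _ _ _ N.+1) //= ltnS divN.
have -> : \sum_(N.+1 <= e < X.+1) \sum_(1 <= f < (X %/ e).+1) F e f = T.
  rewrite hyperbola_exchange // (@big_cat_nat _ _ _ N.+1) //= [X in _ + X]big1_seq; last first.
    move=> f /andP[_]; rewrite mem_index_iota => /andP[Nf _]; rewrite big_geq // ltnS.
    by rewrite -ltnS ltn_divLR /X; nia.
  rewrite addr0; apply: eq_big_nat => f _; apply: eq_bigr => e _; exact: F_sym.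
have hT : `|T| <= 2 * B.
  apply: le_trans (ler_norm_sum _ _ _) _.
  apply: (@le_trans _ _ (\sum_(1 <= e < N.+1) w e * (B * w N.+1))).
    apply: ler_sum => e _.
    have -> : \sum_(N.+1 <= f < (X %/ e).+1) F e f
       = w e * \sum_(N.+1 <= f < (X %/ e).+1) G e f * w f.
      by rewrite mulr_sumr; apply: eq_bigr => f _; rewrite /F; ring.
    by rewrite normrM ger0_norm // ler_wpM2l // G_tail.
  rewrite -mulr_suml mulrCA [leRHS]mulrC ler_wpM2l //.
  have t0 : 0 < Num.sqrt N.+1%:R :> R by rewrite sqrtr_gt0 ltr0n.
  rewrite ler_pdivrMr //; apply: le_trans (w_sum N) _.
  by rewrite ler_pM2l // ler_wsqrtr // ler_nat.
have hQ : `|Q| <= n%:R * B.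
  pose h e := \sum_(1 <= f < N.+1) G e f * w f.
  have -> : Q = \sum_(1 <= e < N.+1) h e * w e.
    apply: eq_bigr => e _; rewrite mulr_suml; apply: eq_bigr => f _.
    by rewrite /F; ring.
  rewrite -[leRHS]mulr1 -[X in _ <= _ * X]w1; apply: abel_bound => // k.
  apply: interval_sum_bound => //.
  - by move=> i; apply: eq_bigr => f _; rewrite G_sym G_mod G_sym.
  - rewrite exchange_big /= big1 // => f _; rewrite -mulr_suml.
    by under eq_bigr do rewrite G_sym; rewrite G_sum mul0r.
  - by move=> i; rewrite -[leRHS]mulr1 -[X in _ <= _ * X]w1; apply: G_tail.
rewrite addrA (_ : Q + T + T = Q + 2 * T); last by ring.
apply: le_trans (ler_normD _ _) _; rewrite normrM ger0_norm //.
lra.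
Qed.

Let r (a : nat) : R := (divisor_sum chi a)%:~R.

Let r_ge0 a : (0 < a)%N -> 0 <= r a.
Proof. by move=> a_gt0; rewrite ler0z (divisor_sum_ge0 chiP). Qed.

Let psi_ge0 a : 0 <= psi a. Proof. exact: ler0n. Qed.

Let squares_sum N : \sum_(1 <= k < N.+1) psi k * k%:R^-1 <=
  \sum_(1 <= a < (N ^ 2).+1) w a * (psi a * r a).
Proof.
have t_ge0 a : (0 < a)%N -> 0 <= w a * (psi a * r a).
  by move=> a_gt0; rewrite !mulr_ge0 // r_ge0.
elim: N => [|N IH]; first by rewrite !big_geq.
rewrite big_nat_recr //= [leRHS](@big_cat_nat _ _ _ (N ^ 2).+1) //=; last by rewrite -!mulnn; nia.
apply: lerD => //; rewrite big_nat_recr /=; last by rewrite -!mulnn; nia.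
rewrite -[leLHS]add0r; apply: lerD.
  by rewrite big_nat_cond sumr_ge0 // => a /andP[/andP[a1 _] _]; apply: t_ge0; lia.
rewrite -mulnn psiM -wM.
have -> : w N.+1 * w N.+1 = N.+1%:R^-1.
  by rewrite -expr2 exprVn sqr_sqrtr.
have r1 : 1 <= r (N.+1 * N.+1) by rewrite ler1z mulnn (divisor_sum_sqr_ge1 chiP).
have -> : psi N.+1 * psi N.+1 = psi N.+1 by rewrite -psiM /psi coprimeMr andbb.
by rewrite mulrC ler_wpM2l ?invr_ge0 // ler_peMr.
Qed.

(** Only the terms k = nj + 1 are kept: they are coprime to n, and 1/k >= 1/(n (j + 1)). *)
Let units_sum M : n%:R^-1 * \sum_(0 <= j < M) j.+1%:R^-1 <=
  \sum_(1 <= k < (n * M).+1) psi k * k%:R^-1.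
Proof.
elim: M => [|M IH]; first by rewrite muln0 !big_geq // mulr0.
rewrite big_nat_recr //= mulrDr [leRHS](@big_cat_nat _ _ _ (n * M).+1) //=; last first.
  by rewrite ltnS leq_mul2l leqnSn orbT.
apply: lerD => //; rewrite big_ltn; last by rewrite ltnS ltn_pmul2l.
rewrite -[leLHS]addr0; apply: lerD; last by rewrite sumr_ge0 // => k _; rewrite mulr_ge0 ?invr_ge0.
have -> : psi (n * M).+1 = 1.
  by rewrite -psi_mod -addn1 mulnC modnMDl psi_mod /psi coprimen1.
rewrite mul1r -invfM -natrM lef_pV2 ?posrE ?ltr0n ?muln_gt0 ?n_gt0 //.
by rewrite ler_nat mulnS; lia.
Qed.

Let sigma_ge1 : 1 <= sigma.
Proof.
have an : (a0 %% n < n)%N by rewrite ltn_pmod.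
rewrite /sigma big_mkord (bigD1 (Ordinal an)) //= g_mod /g Sa0 lerDl.
by apply: sumr_ge0 => i _; apply: ler0n.
Qed.

(* If no a <= N^2 worked, the sum over the hyperbola region of the doubly mean-zero [G] would reduce to - 2 sigma D2, with D2 the weighted sum of the divisor sums prime to n; but D2 is at least the harmonic sum contributed by the squares, whereas the sum of [G] is bounded. *)
Lemma exists_divisor_sum_gt0 : exists a, [/\ (0 < a)%N, S a & 0 < divisor_sum chi a].
Proof.
(* [C] is the bound (n + 4) B of [G_hyperbola]. The exponent in [N] makes [D2] at least (nC + 1) /
   (2n) > C / 2, whereas [sigma >= 1] would give 2 [D2] <= [C]. *)
pose C := ((n + 4) * (n * (3 * n)))%N.
pose N := (n * 2 ^ (n * C).+1)%N; pose X := (N ^ 2)%N.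
have [/existsP[a /and3P[]]|/existsPn none] :=
  boolP [exists a : 'I_X.+1, [&& (0 < a)%N, S a & 0 < divisor_sum chi a]].
  by exists a.
exfalso.
have N0 : (0 < N)%N by rewrite muln_gt0 n_gt0 expn_gt0.
have := G_hyperbola N0; rewrite -/X.
pose D1 := \sum_(1 <= a < X.+1) w a * (g a * r a).
pose D2 := \sum_(1 <= a < X.+1) w a * (psi a * r a).
have D1_eq0 : D1 = 0.
  apply: big1_seq => a /andP[_]; rewrite mem_index_iota => /andP[a_gt0 aX].
  have := none (Ordinal aX); rewrite /= a_gt0 /= /g; case: (S a) => /=; last by rewrite mul0r mulr0.
  rewrite -leNgt => r0; suff -> : r a = 0 by rewrite !mulr0.
  by apply/eqP; rewrite intr_eq0 eq_le r0 (divisor_sum_ge0 chiP).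
have div_eq a e : (0 < a)%N -> e \in divisors a -> (e * (a %/ e))%N = a.
  by move=> a_gt0; rewrite -dvdn_divisors // => /divnK; rewrite mulnC.
have sum1 : \sum_(1 <= e < X.+1) \sum_(1 <= f < (X %/ e).+1) x e * g (e * f) * (w e * w f) = D1.
  rewrite hyperbola_divisors; apply: eq_big_nat => a /andP[a_gt0 _].
  rewrite /r /divisor_sum rmorph_sum mulr_sumr mulr_sumr; apply: eq_big_seq => e ea.
  by rewrite wM div_eq //; rewrite /x /=; ring.
have psi_x e : x e = psi e * x e.
  rewrite /psi /x; case: (boolP (coprime n e)); first by rewrite mul1r.
  by rewrite -(chi_eq0 chiP) => /eqP ->; rewrite mulr0.
pose H e f := x e * psi f * (w e * w f).
have sum2 : \sum_(1 <= e < X.+1) \sum_(1 <= f < (X %/ e).+1) H e f = D2.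
  rewrite hyperbola_divisors; apply: eq_big_nat => a /andP[a_gt0 _].
  rewrite /r /divisor_sum rmorph_sum mulr_sumr mulr_sumr; apply: eq_big_seq => e ea.
  rewrite /H wM div_eq //; have -> : psi a = psi e * psi (a %/ e) by rewrite -psiM div_eq.
  by rewrite -/(x e) {1}psi_x; ring.
have sum3 : \sum_(1 <= e < X.+1) \sum_(1 <= f < (X %/ e).+1) H f e = D2.
  by rewrite -sum2 hyperbola_exchange.
have -> : \sum_(1 <= e < X.+1) \sum_(1 <= f < (X %/ e).+1) G e f * (w e * w f) =
   phi * D1 - sigma * (D2 + D2).
  rewrite -{1}sum2 -sum3 -sum1 -big_split /= !mulr_sumr -sumrB; apply: eq_bigr => e _.
  rewrite -big_split /= !mulr_sumr -sumrB; apply: eq_bigr => f _.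
  by rewrite /G /H; ring.
rewrite D1_eq0 mulr0 sub0r normrN.
have hC : (n%:R + 4) * B = C%:R by rewrite /B /C !natrM natrD.
rewrite hC => le_C.
have D2_large : n%:R^-1 * ((n * C).+1%:R / 2) <= D2.
  apply: le_trans (squares_sum N); apply: le_trans (units_sum _).
  by rewrite ler_wpM2l ?invr_ge0 // harmonic_ge.
have D2_ge0 : 0 <= D2 by apply: le_trans D2_large; rewrite mulr_ge0 ?divr_ge0 ?invr_ge0.
have : D2 + D2 <= C%:R.
  apply: le_trans (le_trans (ler_norm _) le_C).
  by rewrite ler_peMl ?addr_ge0.
have n0 : (n%:R : R) != 0 by rewrite pnatr_eq0 -lt0n.
have : n%:R^-1 * ((n * C).+1%:R / 2) = C%:R / 2 + n%:R^-1 / 2 :> R.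
  by rewrite -natr1 natrM; field.
have : 0 < n%:R^-1 :> R by rewrite invr_gt0 ltr0n.
lra.
Qed.

End Averaging.

Local Close Scope ring_scope.

(** * Binary forms that extend to half-discriminant 23 *)

Definition jacobi n a : int := if coprime n a then ((-1) ^+ gauss_sign n a)%R else 0%R.

Lemma jacobi_real_character n : odd n -> real_character n (jacobi n).
Proof.
move=> on; split=> [a|a b|a]; rewrite /jacobi.
- by rewrite coprime_modr gauss_sign_mod.
- rewrite coprimeMr; case: (boolP (coprime n a)) => ca; last by rewrite mul0r.
  case: (boolP (coprime n b)) => cb; last by rewrite mulr0.
  by rewrite gauss_signM // signr_addb.
- by case: coprime; rewrite ?expr0n // sqrr_sign.
Qed.

Lemma sqrt_opp_squarefree n a : odd a ->
  (forall r, prime r -> r %| a -> ~~ (r ^ 2 %| a) /\ exists w, r %| w ^ 2 + n) ->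
  exists w, a %| w ^ 2 + n.
Proof.
elim/ltn_ind: a => a IH oa h.
have [a1|a1] := leqP a 1; first by exists 0; case: a a1 oa {IH h} => [|[|]].
have pr := pdiv_prime a1; have [nsq [w1 hw1]] := h _ pr (pdiv_dvd a).
move: pr nsq hw1; have /dvdnP[b Eb] := pdiv_dvd a; move: (pdiv a) Eb => r Eb pr nsq hw1.
have r1 := prime_gt1 pr.
have b0 : 0 < b by case: b Eb => //; rewrite mul0n; lia.
have co : coprime r b.
  rewrite prime_coprime //; apply: contra nsq => rb.
  by rewrite Eb -mulnn dvdn_mul.
have [||p pp pb|w2 hw2] := IH b; first by rewrite Eb -[X in X < _]muln1 ltn_pmul2l.
- by move: oa; rewrite Eb oddM => /andP[].
- have [nsp hp] : ~~ (p ^ 2 %| a) /\ exists w, p %| w ^ 2 + n by apply: h; rewrite // Eb dvdn_mulr.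
  by split=> //; apply: contra nsp => pb2; rewrite Eb dvdn_mulr.
exists (chinese r b w1 w2); rewrite Eb mulnC Gauss_dvd //; apply/andP; split.
  by rewrite /dvdn -modnDml -modnXm chinese_modl // modnXm modnDml.
by rewrite /dvdn -modnDml -modnXm chinese_modr // modnXm modnDml.
Qed.

Lemma exists_binary_form n m : n %% 8 = 3 -> coprime n 23 -> n = m ^ 2 %[mod 23] ->
  exists a u w, [/\ 0 < a, 4 * a %| w ^ 2 + n & n %| a * u ^ 2 + 23].
Proof.
move=> n8 co23 n23.
have on : odd n by rewrite (divn_eq n 8) n8 oddD oddM andbF.
have n1 : 1 < n by case: n n8 {co23 n23 on} => [|[|]].
have n0 : 0 < n by lia.
have chiP := jacobi_real_character on.
have odd_h : odd n./2.
  rewrite (divn_eq n 8) n8; have -> : (n %/ 8 * 8 + 3)./2 = 2 * (2 * (n %/ 8)) + 1 by lia.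
  by rewrite oddD oddM.
have co1 : coprime n n.-1 by rewrite coprimenP.
have chi_opp1 : jacobi n n.-1 = (-1)%R.
  by rewrite /jacobi co1 gauss_sign_opp1 // odd_h.
have com : coprime 23 m.
  by rewrite -(@coprime_pexpr 2) // -coprime_modr -n23 coprime_modr coprime_sym.
have g23 : gauss_sign 23 n = false.
  by rewrite -gauss_sign_mod n23 gauss_sign_mod -mulnn gauss_signM // addbb.
have chi_23 : jacobi n 23 = (-1)%R.
  have := gauss_reciprocity on (isT : odd 23) co23.
  by rewrite /jacobi co23 g23 addbF oddM odd_h => ->.
pose S a := [exists u : 'I_n, n %| a * u ^ 2 + 23].
have SP a u : n %| a * u ^ 2 + 23 -> S a.
  move=> h; apply/existsP; exists (Ordinal (ltn_pmod u n0)); move: h => /=.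
  by rewrite /dvdn -modnDml -modnMmr -modnXm modnMmr modnDml.
have S_mod a : S (a %% n) = S a.
  by apply: eq_existsb => u; rewrite /dvdn -[in RHS]modnDml -modnMml modnDml.
(* From a u^2 = -23 modulo n, chi(a) = chi(-1) chi(23) = (-1)(-1): n is 3 modulo 4, and by
   reciprocity (23/n) = -(n/23) = -1. *)
have S_chi a : S a -> jacobi n a = 1%R.
  case/existsP=> u hu.
  have E : jacobi n (a * u ^ 2) = jacobi n (n.-1 * 23).
    rewrite -(chi_mod chiP) -[in RHS](chi_mod chiP); congr (jacobi n _).
    apply/eqP; rewrite -(eqn_modDr 23); apply/eqP; move/eqP: hu => ->.
    have -> : n.-1 * 23 + 23 = 23 * n by lia.
    by rewrite modnMl.
  move: E; rewrite -mulnn !(chiM chiP) chi_opp1 chi_23 mulrNN mulr1 => E.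
  have := chi_sqr chiP u; rewrite expr2 => Eu; move: E; rewrite Eu.
  by case: coprime => //=; rewrite ?mulr1 ?mulr0.
have S1 : S (n.-1 * 23).
  apply: (SP _ 1); have -> : n.-1 * 23 * 1 ^ 2 + 23 = 23 * n by lia.
  exact: dvdn_mull.
(* The averages involve only rational numbers and square roots, so the real algebraic numbers can
   serve as the real closed field. *)
have [a [a0 Sa Ra]] := @exists_divisor_sum_gt0 realalg _ _ _ _ _ n0 chiP S_mod S_chi S1 chi_opp1.
have Sdiv r b : prime r -> S (r ^ 2 * b) -> S b.
  move=> pr /existsP[u hu]; apply: (SP _ (r * u)).
  by rewrite expnMn mulnA [b * _]mulnC.
have Sco b : S b -> coprime n b.
  by move=> /S_chi cb; rewrite -[coprime _ _]negbK -(chi_eq0 chiP) cb.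
have [b [b0 Sb bP]] := minimal_divisor_sum chiP Sdiv Sco a0 Sa Ra.
(* As n is 3 modulo 8, 2 is a nonresidue; this keeps b odd, hence coprime to the factor 4 still to
   be gained. *)
have chi2 : jacobi n 2 != 1%R.
  by rewrite /jacobi gauss_sign_2 // coprimen2 on.
have ob : odd b.
  rewrite -[odd b]negbK -dvdn2; apply/negP => b2.
  by have [E _] := bP 2 isT b2; rewrite E eqxx in chi2.
have [w hw] : exists w, b %| w ^ 2 + n.
  apply: sqrt_opp_squarefree => // r pr rb; have [chir nsq] := bP r pr rb; split=> //.
  have odr : odd r by apply: dvdn_odd rb ob.
  have r1 := prime_gt1 pr.
  have cor : coprime n r by apply: coprime_dvdr rb (Sco _ Sb).
  have gr : gauss_sign n r = false by move: chir; rewrite /jacobi cor; case: gauss_sign.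
  have corn : coprime r n by rewrite coprime_sym.
  have cor1 : coprime r r.-1 by rewrite coprimenP // prime_gt0.
  (* Since n is 3 modulo 4 and (r/n) = 1, reciprocity reads (n/r) = (-1)^((r-1)/2) = (-1/r), so -n
     is a square modulo r. *)
  have := gauss_reciprocity on odr cor; rewrite gr addFb oddM odd_h andTb => grn.
  have gopp : gauss_sign r (n * r.-1) = false.
    by rewrite gauss_signM // gauss_sign_opp1 // grn addbb.
  have [|w hw] := gauss_sign_prime pr odr _ gopp; first by rewrite coprimeMr corn.
  exists w; rewrite /dvdn -modnDml hw modnDml.
  by rewrite -mulnSr prednK ?modnMl // prime_gt0.
(* Adding the odd b corrects the parity of w; then w'^2 + n is 1 + 3 = 0 modulo 4. *)
have [w' ow' hw'] : exists2 w', odd w' & b %| w' ^ 2 + n.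
  case: (boolP (odd w)) => ow; first by exists w.
  exists (w + b); first by rewrite oddD ob addbT.
  have -> : (w + b) ^ 2 + n = w ^ 2 + n + b * (2 * w + b) by rewrite -!mulnn; nia.
  by rewrite dvdn_add // dvdn_mulr.
have /existsP[u hu] := Sb.
exists b, u, w'; split=> //; rewrite Gauss_dvd; last by rewrite (@coprimeXl 2 2) // coprime2n.
rewrite hw' andbT; apply/dvdnP.
have Ew : w' = w'./2.*2.+1 by rewrite -[LHS]odd_double_half ow'.
exists (w'./2 * w'./2 + w'./2 + 2 * (n %/ 8) + 1).
by rewrite {1}Ew [in LHS](divn_eq n 8) n8 -!mulnn; nia.
Qed.

(** * Return to Z and conclusion *)

Unset Implicit Arguments.
From Stdlib Require Import ZArith Znumtheory.
Open Scope Z_scope.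

Lemma of_nat_modn (k d : nat) : (0 < d)%nat -> Z.of_nat (k %% d) = Z.of_nat k mod Z.of_nat d.
Proof.
move=> d0; have := divn_eq k d; have := ltn_pmod k d0.
move: (k %/ d)%nat (k %% d)%nat => q r rd Ek.
apply: (Z.mod_unique _ _ (Z.of_nat q)); first by left; lia.
by rewrite Ek -Nat2Z.inj_mul -Nat2Z.inj_add; congr Z.of_nat; rewrite mulnC.
Qed.

Lemma exists_binary_form_Z (n m : Z) :
  0 < n -> n mod 8 = 3 -> n mod 23 <> 0 -> 0 < m -> (n - m * m) mod 23 = 0 ->
  exists a b c u w : Z, 0 < a /\ w * w + n = 4 * a * b /\ n * c = a * u * u + 23.
Proof.
move=> n0 n8 n23 m0 nm.
have [n' En] := Z_of_nat_complete n (Z.lt_le_incl _ _ n0).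
have [m' Em] := Z_of_nat_complete m (Z.lt_le_incl _ _ m0).
rewrite En Em in n0 n8 n23 m0 nm *.
have [|||a [u [w [a0 /dvdnP[b Eb] /dvdnP[c Ec]]]]] := @exists_binary_form n' m'.
- by apply: Nat2Z.inj; rewrite of_nat_modn.
- rewrite coprime_sym prime_coprime // /dvdn; apply/negP => /eqP E.
  by apply: n23; rewrite -(of_nat_modn n' 23) // E.
- apply: Nat2Z.inj; rewrite !of_nat_modn // -mulnn Nat2Z.inj_mul.
  change (Z.of_nat 23) with 23; have [k Hk] := proj1 (Z.mod_divide _ 23 ltac:(discriminate)) nm.
  have -> : Z.of_nat n' = Z.of_nat m' * Z.of_nat m' + k * 23.
    by rewrite -Hk Z.add_comm Z.sub_add.
  exact: Z.mod_add.
exists (Z.of_nat a), (Z.of_nat b), (Z.of_nat c), (Z.of_nat u), (Z.of_nat w).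
move: Eb Ec; rewrite -!mulnn => Eb Ec; split; [|split]; lia.
Qed.

Lemma sum_bform_large (p : Z) :
  Z.odd p = true -> p mod 23 <> 0 -> 73 <= p -> exists x y z t, bform x y + bform z t = p.
Proof.
move=> odd_p p23 p73; have [s [good lt]] := exists_good_trace p odd_p p23 p73.
have [odd_s [adm [n8 [n23 [m [m0 nm]]]]]] := good_traceP p s good.
have n0 : 0 < 4 * p - s * s by lia.
have [a [b [c [u [w [a0 [Eb Ec]]]]]]] := exists_binary_form_Z _ m n0 n8 n23 m0 nm.
exact: (ternary_sum_bform p s a b c u w).
Qed.

Lemma prime_sum_bform (p : Z) :
  Znumtheory.prime p -> p <> 2 -> p <> 5 -> p <> 7 -> p <> 23 ->
  exists x y z t, bform x y + bform z t = p.
Proof.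
move=> pr p2 p5 p7 p23; have p_gt1 : 1 < p by case: pr.
have ndiv d : 1 < d -> (d | p) -> d = p.
  by move=> d1 /(prime_divisors p pr); lia.
have [p73|p73] := Z_lt_le_dec p 73; last first.
  apply: sum_bform_large => //.
  - rewrite -Z.negb_even; apply/negP => /Z.even_spec[k Hk].
    by apply: p2; rewrite -(ndiv 2) //; exists k; lia.
  - by move=> /Z.mod_divide h; apply: p23; rewrite -(ndiv 23) //; apply: h.
by apply: small_primes_sum_bform => // d d1 /(ndiv d d1).
Qed.

Theorem theorem3p8 (p : Z) :
  prime p -> p <> 2 -> p <> 5 -> p <> 7 -> p <> 23 ->
  exists a b c d : Z,
    a mod 3 = d mod 3 /\ b mod 3 = c mod 3 /\
    3 * p = a ^ 2 + 23 * b ^ 2 + c ^ 2 + 23 * d ^ 2.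
Proof.
intros pr p2 p5 p7 p23.
destruct (prime_sum_bform p pr p2 p5 p7 p23) as (x & y & z & t & <-).
exists (y + x * 3), t, (t + z * 3), y.
rewrite !Z.mod_add; [|lia|lia].
split; [reflexivity|split; [reflexivity|]].
unfold bform; ring.
Qed.
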